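(* Let $n\in\mathbb{N}$, $P_1,\ldots,P_n\in\mathcal{P}_3$, $\sigma_i:=\sigma(P_i)$, $Q_i:=\frac12(\delta_{-\sigma_i}+\delta_{\sigma_i})$, $\sigma:=\big(\sum_{i=1}^n\sigma_i^2\big)^{1/2}$, and $\varrho_i:=\varrho(P_i)$. Then $$\zeta_3\left(\widetilde{\mathop{\ast}_{i=1}^n P_i}\,,\ \widetilde{\mathop{\ast}_{i=1}^n Q_i}\right)\ \le\ \frac{1}{6\sigma^3}\sum_{i=1}^n\sigma_i^3B(\varrho_i),$$ with equality whenever each $P_i$ is a two-point law and also the centred third moments $\int(x-\mu(P_i))^3\,dP_i(x)$ are all $\ge0$ or all $\le0$.
   Context: $\mathcal{P}_3$ is the set of all probability laws $P$ on $\mathbb{R}$ with $\int|x|^3\,dP(x)<\infty$ and variance $\sigma^2(P)>0$; $\mu(P)$ is the mean and $\sigma(P)$ the standard deviation. For such $P$, the standardization $\widetilde P$ is the image of $P$ under $x\mapsto (x-\mu(P))/\sigma(P)$, and $\varrho(P):=\int\left|\frac{x-\mu(P)}{\sigma(P)}\right|^3dP(x)\ (\ge1)$. $\mathop{\ast}_{i=1}^nP_i$ is the convolution of $P_1,\ldots,P_n$; $\delta_a$ is the one-point law at $a$; $Pf:=\int f\,dP$. $B(\rho):=\sqrt{\tfrac12\rho^2+\tfrac12\rho\sqrt{\rho^2+8}-2}$ for $\rho\in[1,\infty[$. Zolotarev distance of order 3: for probability laws $P,Q$ on $\mathbb{R}$, $\zeta_3(P,Q):=\sup_{f\in\mathcal{F}_3^\infty}|Pf-Qf|$,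 where $\mathcal{F}_3^\infty$ is the set of bounded, twice continuously differentiable functions $f:\mathbb{R}\to\mathbb{R}$ with $|f''(x)-f''(y)|\le|x-y|$ for all $x,y\in\mathbb{R}$. *)

(* Defs.v *)
From HB Require Import structures.
From mathcomp Require Import all_boot all_order all_algebra.
From mathcomp Require Import all_classical all_reals all_analysis.
From mathcomp Require Import measurable_realfun.
Set Implicit Arguments.
Unset Strict Implicit.
Unset Printing Implicit Defensive.
Import Order.TTheory GRing.Theory Num.Theory.
Import numFieldNormedType.Exports.
Local Open Scope classical_set_scope.
Local Open Scope ring_scope.

Notation law R := (probability R R).

Section moments.
Context {R : realType}.
Implicit Type P : law R.

(* [fine] sends infinite (undefined) values to 0; the quantities below are only
   meaningful for [P] in [P3]. *)
Definition mean P : R := fine 'E_P[idfun].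

Definition stddev P : R := Num.sqrt (fine 'V_P[idfun]).

Definition P3 : set (law R) :=
  [set P : law R | (\int[P]_x (`|x| ^+ 3)%:E < +oo)%E /\ (0 < 'V_P[idfun])%E].

Definition rho3 P : R :=
  fine 'E_P[fun x => `|(x - mean P) / stddev P| ^+ 3].

Definition centred_moment3 P : R := fine 'E_P[fun x => (x - mean P) ^+ 3].

(* Measures are only specified on measurable sets, hence the restriction. *)
Definition two_point P := exists a b p : R,
  [/\ a != b, 0 < p < 1 &
      forall A, measurable A -> P A = (p%:E * \d_a A + (1 - p)%:E * \d_b A)%E].

End moments.

Section standardization.
Context {R : realType}.
Implicit Type P : law R.

Definition std_map P : R -> R := fun x => (x - mean P) / stddev P.

Lemma measurable_std_map P : measurable_fun [set: R] (std_map P).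
Proof.
apply: measurable_funM => //.
by apply: measurable_funB => //; exact: measurable_id.
Qed.

HB.instance Definition _ P := isMeasurableFun.Build _ _ _ _
  (std_map P) (measurable_std_map P).

Definition standardize P : law R := distribution P (std_map P).

End standardization.

Section convolution.
Context {R : realType}.
Implicit Types P Q : law R.

Definition addition : R * R -> R := fun z => z.1 + z.2.

Lemma measurable_addition : measurable_fun [set: R * R] addition.
Proof. exact: measurable_funD. Qed.

HB.instance Definition _ := isMeasurableFun.Build _ _ _ _
  addition measurable_addition.

Definition prod_law P Q := (P \x Q)%E.

HB.instance Definition _ P Q := Measure.on (prod_law P Q).

Lemma prod_law_setT P Q : prod_law P Q setT = 1%E.
Proof.
rewrite /prod_law -setXTT [LHS]product_measure1E//.
by rewrite [X in (X * _)%E]probability_setT mul1e; exact: probability_setT.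
Qed.

HB.instance Definition _ P Q := Measure_isProbability.Build _ _ _
  (prod_law P Q) (prod_law_setT P Q).

Definition convolution P Q : law R := distribution (prod_law P Q) addition.

Definition convolutions n (P : 'I_n -> law R) : law R :=
  \big[convolution/(\d_(0 : R) : law R)]_(i < n) P i.

End convolution.

Section symmetric_two_point.
Context {R : realType}.
Variable s : R.

Definition sym_two_point_measure : set R -> \bar R :=
  mscale (2^-1)%:nng (measure_add \d_(- s) \d_s).

HB.instance Definition _ := Measure.on sym_two_point_measure.

Lemma sym_two_point_measure_setT : sym_two_point_measure setT = 1%E.
Proof.
rewrite /sym_two_point_measure /mscale [X in (_ * X)%E]measure_addE.
rewrite [X in (_ * (X + _))%E]diracT [X in (_ * (_ + X))%E]diracT.
by rewrite -EFinD -EFinM mulVf.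
Qed.

HB.instance Definition _ := Measure_isProbability.Build _ _ _
  sym_two_point_measure sym_two_point_measure_setT.

Definition sym_two_point : law R := sym_two_point_measure.

End symmetric_two_point.

Section zeta3.
Context {R : realType}.

Definition F3 : set (R -> R) :=
  [set f : R -> R | [/\ bounded_fun f,
      forall x, derivable f x 1,
      forall x, derivable (derive1 f) x 1,
      continuous (derive1n 2 f) &
      forall x y, `|derive1n 2 f x - derive1n 2 f y| <= `|x - y| ]].

Definition zeta3 (P Q : law R) : \bar R :=
  ereal_sup [set `| (\int[P]_x (f x)%:E) - (\int[Q]_x (f x)%:E) |%E | f in F3].

End zeta3.

Definition B {R : realType} (rho : R) : R :=
  Num.sqrt (2^-1 * rho ^+ 2 + 2^-1 * rho * Num.sqrt (rho ^+ 2 + 8) - 2).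

(* Main.v *)
(** Write [avg f = (f 1 + f (-1)) / 2].  For a standardized law [P] and [f] with
1-Lipschitz second derivative, the claim is [P f - avg f <= B (rho P) / 6].
Let [l > 1] be the slope of a tangent of the concave function [B].  The second
derivative of [F = f - l |x|^3 / 6] increases before [0] and decreases after
[0], so a quadratic touching [F] from above at two points [v < 0 < u] majorizes
[F] everywhere.  Hence [P F] is largest for a two-point law: such [u] and
[v = -1/u] exist because the mean of [F] under the standardized law on
[{u, -1/u}] attains its maximum in [u].  For two-point laws a divided difference
of order 3 on [-1, v, 1, u] gives [P f - avg f <= |third moment| / 6], and the
third moment of such a law is [B] of its absolute third moment up to sign.  The
tangent inequality of [B] concludes.  Exchanging the summands one at a time
gives the bound for convolutions; equality is seen by testing with
[- N^3 sin (x / N)], which tends to [x^3 / 6] modulo linear functions. *)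
Require Import Defs.
From mathcomp Require Import all_boot all_order all_algebra.
From mathcomp Require Import all_classical all_reals all_analysis.
From mathcomp Require Import measurable_realfun ring lra.
Set Implicit Arguments.
Unset Strict Implicit.
Unset Printing Implicit Defensive.
Import Order.TTheory GRing.Theory Num.Theory.
Import numFieldNormedType.Exports.
Local Open Scope classical_set_scope.
Local Open Scope ring_scope.

(** * Differentiation on the line and a positivity criterion from double zeros *)

Section calculus.
Context {R : realType}.
Implicit Types (f h D : R -> R) (a b x y : R).

Lemma mvt_global f (f1 : R -> R) a b : (forall x, is_derive x 1 f (f1 x)) ->
  a < b -> exists c, [/\ a < c, c < b & f b - f a = f1 c * (b - a)].
Proof.
move=> df ab.
have [|c cab ->] := @MVT R f f1 a b ab (fun x _ => df x).
  apply: continuous_subspaceT => x.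
  by apply/differentiable_continuous/derivable1_diffP; case: (df x).
by exists c; move: cab; rewrite in_itv/= => /andP[].
Qed.

Lemma rolle_global f (f1 : R -> R) a b : (forall x, is_derive x 1 f (f1 x)) ->
  a < b -> f a = f b -> exists c, [/\ a < c, c < b & f1 c = 0].
Proof.
move=> df ab fab; have [c [ac cb]] := mvt_global df ab.
rewrite fab subrr => /esym/eqP; rewrite mulf_eq0 subr_eq0 (gt_eqF ab) orbF.
by move=> /eqP f1c; exists c.
Qed.

Lemma derive_ge0_le f (f1 : R -> R) a b : (forall x, is_derive x 1 f (f1 x)) ->
  (forall x, a < x < b -> 0 <= f1 x) -> a <= b -> f a <= f b.
Proof.
move=> df f1ge0; rewrite le_eqVlt => /predU1P[-> //|ab].
have [c [ac cb e]] := mvt_global df ab.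
by rewrite -subr_ge0 e mulr_ge0 ?subr_ge0 ?(ltW ab)// f1ge0// ac.
Qed.

Lemma derive_le0_ge f (f1 : R -> R) a b : (forall x, is_derive x 1 f (f1 x)) ->
  (forall x, a < x < b -> f1 x <= 0) -> a <= b -> f b <= f a.
Proof.
move=> df f1le0; rewrite le_eqVlt => /predU1P[-> //|ab].
have [c [ac cb e]] := mvt_global df ab.
rewrite -subr_ge0 -opprB e -mulNr mulr_ge0 ?subr_ge0 ?(ltW ab)// oppr_ge0.
by rewrite f1le0// ac.
Qed.

(** A quadratic remainder can be checked by elementary inequalities, so [y * |y|] is differentiated
    at all points at once, including 0, where the sign changes. *)
Lemma is_derive_quadratic_error f x l :
  (forall y, `|f y - f x - l * (y - x)| <= (y - x) ^+ 2) -> is_derive x 1 f l.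
Proof.
move=> H.
suff cvgl : (fun h : R => h^-1 *: (f (h *: 1 + x) - f x)) @ 0^' --> l.
  apply: DeriveDef; first by apply/cvg_ex; exists l.
  by apply/cvg_lim.
apply/cvgrPdist_le => e e0.
near=> t.
have t0 : t != 0 by near: t; exact: nbhs_dnbhs_neq.
have := H (t *: 1 + x); rewrite addrK /GRing.scale/= mulr1 => Ht.
rewrite -(ler_pM2l (_ : 0 < `|t|)) ?normr_gt0//.
rewrite -normrM mulrBr mulrA mulfV// mul1r distrC [t * l]mulrC.
rewrite (le_trans Ht)// -real_normK ?num_real// expr2 ler_pM2l ?normr_gt0//.
near: t; apply: dnbhs0_le => //.
Unshelve. all: by end_near.
Qed.

Lemma is_derive_mul_norm x : is_derive x 1 (fun y : R => y * `|y|) (2 * `|x|).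
Proof.
apply: is_derive_quadratic_error => y; rewrite ler_norml.
have := sqr_ge0 x; have := sqr_ge0 y; have := sqr_ge0 (y - x).
by have [x0|x0] := ger0P x; have [y0|y0] := ger0P y => *; apply/andP; split; nra.
Qed.

Lemma is_derive_norm_cube x :
  is_derive x 1 (fun y : R => `|y| ^+ 3) (3 * (x * `|x|)).
Proof.
have d := is_derive_mul_norm x.
rewrite (_ : (fun y => _) = (fun y => y * `|y|) * id); last first.
  apply/funext => y /=; rewrite /GRing.mul/= exprS real_normK ?num_real//.
  by rewrite expr2 mulrCA mulrA [y * _ * y]mulrAC.
apply: is_derive_eq; rewrite /GRing.scale/=; ring.
Qed.

(* [D''] vanishes between the double zeros [v < 0 < u]; the monotonicity
   hypotheses then make [D] convex-concave-convex. *)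
Lemma double_zeros_ge0 D (D1 D2 : R -> R) u v :
  (forall x, is_derive x 1 D (D1 x)) -> (forall x, is_derive x 1 D1 (D2 x)) ->
  (forall x y, x < y -> 0 <= x -> D2 x < D2 y) ->
  (forall x y, x < y -> y <= 0 -> D2 y < D2 x) ->
  v < 0 -> 0 < u -> D u = 0 -> D v = 0 -> D1 u = 0 -> D1 v = 0 ->
  forall x, 0 <= D x.
Proof.
move=> dD dD1 incr decr v0 u0 Du Dv D1u D1v.
(* With the zeros of [D1] at [v] and [u], the extra zero [w] gives [D2] two zeros [z1 < w < z2]. *)
have [||w [vw wu D1w]] := rolle_global dD (a := v) (b := u); [lra..|].
have [||z1 [vz1 z1w D2z1]] := rolle_global dD1 (a := v) (b := w); [lra..|].
have [||z2 [wz2 z2u D2z2]] := rolle_global dD1 (a := w) (b := u); [lra..|].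
(* Two zeros of [D2] cannot lie on the same side of 0, where [D2] is strictly monotone. *)
have z20 : 0 < z2 by rewrite ltNge; apply/negP => /(decr _ _ (lt_trans z1w wz2)); lra.
have z10 : z1 < 0 by rewrite ltNge; apply/negP => /(incr _ _ (lt_trans z1w wz2)); lra.
have D2r x : z2 <= x -> 0 <= D2 x.
  by rewrite le_eqVlt => /predU1P[<-|/incr/(_ (ltW z20))]; rewrite D2z2// => /ltW.
have D2l x : x <= z1 -> 0 <= D2 x.
  by rewrite le_eqVlt => /predU1P[->|/decr/(_ (ltW z10))]; rewrite D2z1// => /ltW.
have D2m x : z1 <= x <= z2 -> D2 x <= 0.
  move=> /andP[z1x xz2]; have [x0|x0] := leP x 0.
    by move: z1x; rewrite le_eqVlt => /predU1P[<-|/decr/(_ x0)]; lra.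
  by move: xz2; rewrite le_eqVlt => /predU1P[->|/incr/(_ (ltW x0))]; lra.
(* Beyond [z2], [D] is convex with a horizontal tangent at its zero [u]; [Dl] mirrors this at
   [v]. *)
have Dr x : z2 <= x -> 0 <= D x.
  move=> z2x; rewrite -Du; have [ux|xu] := leP u x.
    apply: (derive_ge0_le dD) => // y /andP[uy yx]; rewrite -D1u.
    by apply: (derive_ge0_le dD1); [move=> t /andP[ut ty]; apply: D2r|]; lra.
  apply: (derive_le0_ge dD); last exact: ltW.
  move=> y /andP[xy yu]; rewrite -D1u.
  by apply: (derive_ge0_le dD1); [move=> t /andP[yt tu]; apply: D2r|]; lra.
have Dl x : x <= z1 -> 0 <= D x.
  move=> xz1; rewrite -Dv; have [xv|vx] := leP x v.
    apply: (derive_le0_ge dD) => // y /andP[xy yv]; rewrite -D1v.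
    by apply: (derive_ge0_le dD1); [move=> t /andP[ut ty]; apply: D2l|]; lra.
  apply: (derive_ge0_le dD); last exact: ltW.
  move=> y /andP[vy yx]; rewrite -D1v.
  by apply: (derive_ge0_le dD1); [move=> t /andP[yt tu]; apply: D2l|]; lra.
move=> x; have [xz1|z1x] := leP x z1; first exact: Dl.
have [z2x|xz2] := leP z2 x; first exact: Dr.
(* Between [z1] and [z2], concavity and [D1 w = 0] make [D] rise up to [w] and then fall, so it is
   bounded below by its value at [z1] or at [z2]. *)
have [xw|wx] := leP x w.
  apply: (le_trans (Dl _ (lexx z1))); apply: (derive_ge0_le dD) => //; last lra.
  move=> y /andP[z1y yx]; rewrite -D1w.
  by apply: (derive_le0_ge dD1); [move=> t /andP[yt tu]; apply: D2m|]; lra.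
apply: (le_trans (Dr _ (lexx z2))); apply: (derive_le0_ge dD) => //; last lra.
move=> y /andP[z1y yx]; rewrite -D1w.
by apply: (derive_le0_ge dD1); [move=> t /andP[yt tu]; apply: D2m|]; lra.
Qed.

End calculus.

(** * Two-point laws: comparison with the symmetric law, and tangents of [B] *)

Section two_point_extremality.
Context {R : realType}.
Implicit Types (f h : R -> R) (k m u x y : R).

(* The mean of [f] under the standardized law on [{u, -1/u}]. *)
Definition std_two_point_mean f u : R := (f u + u ^+ 2 * f (- u^-1)) / (1 + u ^+ 2).

Definition sym_mean f : R := (f 1 + f (-1)) / 2.

(* The defect is a positive multiple of [e u], where [e] is [h] minus its
   quadratic interpolant at [-1], [-1/u], [1]. *)
Lemma sym_mean_le_std_two_point_mean h (h1 h2 : R -> R) u :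
  (forall x, is_derive x 1 h (h1 x)) -> (forall x, is_derive x 1 h1 (h2 x)) ->
  (forall x y, x <= y -> h2 x <= h2 y) -> 1 <= u ->
  sym_mean h <= std_two_point_mean h u.
Proof.
move=> dh dh1 h2nd; rewrite /sym_mean /std_two_point_mean.
rewrite le_eqVlt => /predU1P[<-|u1].
  by rewrite invr1 expr1n mul1r.
set v := - u^-1.
have u0 : 0 < u by lra.
have uv : u * v = -1 by rewrite /v mulrN mulfV// gt_eqF.
have v0 : v < 0 by rewrite /v oppr_lt0 invr_gt0.
have v1 : -1 < v by rewrite /v ltrN2 invf_lt1.
(* The interpolant is [A - C + B x + C x^2]: [A] and [B] are the even and odd parts of [h] at 1, and
   [C] is fixed by the value at [v]. *)
pose A := (h 1 + h (-1)) / 2; pose B := (h 1 - h (-1)) / 2.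
pose C := (h v - A - B * v) / (v ^+ 2 - 1).
have v21 : v ^+ 2 - 1 != 0 by nra.
pose e x := h x - (A - C + B * x + C * x ^+ 2).
pose e1 x := h1 x - (B + 2 * C * x).
pose e2 x := h2 x - 2 * C.
have de x : is_derive x 1 e (e1 x).
  by rewrite /e/=; apply: is_derive_eq; rewrite /e1 /GRing.scale/=; ring.
have de1 x : is_derive x 1 e1 (e2 x).
  by rewrite /e1/=; apply: is_derive_eq; rewrite /e2 /GRing.scale/=; ring.
have e_1 : e (-1) = 0 by rewrite /e /A /B; field.
have ev : e v = 0 by rewrite /e /C; field.
have e1_ : e 1 = 0 by rewrite /e /A /B; field.
(* Three zeros of [e] give zeros [w1 < w2] of [e1] and a zero [z] of [e2] between these. As [e2] is
   nondecreasing, [e1] is nonnegative beyond [w2 < 1], so [e] does not fall from 1 to [u]. *)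
have [|w1 [_ w1v e1w1]] := rolle_global de v1; first by rewrite e_1 ev.
have [||w2 [vw2 w21 e1w2]] := rolle_global de (a := v) (b := 1); [lra|lra|].
have [||z [_ zw2 e2z]] := rolle_global de1 (a := w1) (b := w2); [lra|lra|].
have eu : 0 <= e u.
  rewrite -e1_; apply: (derive_ge0_le de) => [x /andP[x1 xu]|]; last exact: ltW.
  rewrite -e1w2; apply: (derive_ge0_le de1) => [y /andP[yw2 yx]|]; last lra.
  by rewrite -e2z lerD2r h2nd; lra.
have -> : h u = e u + (A - C + B * u + C * u ^+ 2) by rewrite /e; ring.
have -> : h v = A - C + B * v + C * v ^+ 2 by move: ev; rewrite /e; lra.
rewrite ler_pdivlMr; last by nra.
rewrite -/A.
(* The interpolant has the same mean [A] under both laws: the remaining terms carry factors that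
   vanish for [u * v = -1]. *)
have -> : e u + (A - C + B * u + C * u ^+ 2) +
    u ^+ 2 * (A - C + B * v + C * v ^+ 2) =
    e u + A * (1 + u ^+ 2) + C * ((u * v) ^+ 2 - 1) + B * u * (1 + u * v) by ring.
by rewrite uv; nra.
Qed.

(** The function [x^3 / 6 - f] has a nondecreasing second derivative, so the preceding comparison
    applies to it. The cube contributes the third moment [u - 1/u] on one side and 0 on the
    symmetric side. *)
Lemma std_two_point_mean_sub_le f (f1 f2 : R -> R) u :
  (forall x, is_derive x 1 f (f1 x)) -> (forall x, is_derive x 1 f1 (f2 x)) ->
  (forall x y, `|f2 x - f2 y| <= `|x - y|) -> 0 < u ->
  std_two_point_mean f u - sym_mean f <= `|u - u^-1| / 6.
Proof.
wlog u1 : f f1 f2 u / 1 <= u => [wlogH|].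
  (* Reflection turns the standardized law on [{u, -1/u}] into the one on [{1/u, -u}], which settles
     [u < 1]. *)
  have [u1|/ltW u1] := leP 1 u; first exact: (wlogH f f1 f2).
  move=> df df1 f2lip u0.
  have := wlogH (fun x => f (- x)) (fun x => - f1 (- x)) (fun x => f2 (- x)) u^-1.
  rewrite invf_ge1// => /(_ u1); rewrite invrK distrC.
  rewrite (_ : std_two_point_mean (fun x => f (- x)) u^-1 = std_two_point_mean f u).
    rewrite (_ : sym_mean (fun x => f (- x)) = sym_mean f); last first.
      by rewrite /sym_mean opprK addrC.
    apply.
    - move=> x; apply: is_derive_eq.
      by rewrite /GRing.scale/=; ring.
    - move=> x; apply: is_derive_eq.
      by rewrite /GRing.scale/=; ring.
    - by move=> x y; rewrite (le_trans (f2lip _ _))// -opprD normrN.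
    - by rewrite invr_gt0.
  rewrite /std_two_point_mean invrK opprK.
  by field; rewrite gt_eqF//=; nra.
move=> df df1 f2lip u0.
pose h x := 6^-1 * x ^+ 3 - f x.
pose h1 x := 2^-1 * x ^+ 2 - f1 x.
pose h2 x := x - f2 x.
have dh x : is_derive x 1 h (h1 x).
  by rewrite /h/=; apply: is_derive_eq; rewrite /h1 /GRing.scale/=; field.
have dh1 x : is_derive x 1 h1 (h2 x).
  by rewrite /h1/=; apply: is_derive_eq; rewrite /h2 /GRing.scale/=; field.
have h2nd x y : x <= y -> h2 x <= h2 y.
  move=> xy; rewrite /h2; have := f2lip y x.
  by rewrite [X in _ <= X]ger0_norm ?subr_ge0// ler_norml => /andP[]; lra.
have := sym_mean_le_std_two_point_mean dh dh1 h2nd u1.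
have -> : sym_mean h = - sym_mean f by rewrite /sym_mean /h; field.
have -> : std_two_point_mean h u = (u - u^-1) / 6 - std_two_point_mean f u.
  rewrite /std_two_point_mean /h.
  by field; rewrite gt_eqF//=; nra.
rewrite [`|u - _|]ger0_norm; first lra.
by rewrite subr_ge0 (le_trans _ u1)// invf_le1.
Qed.

(* [B] at [k - 2/k] is [sqrt (k^2 - 4)] and has derivative [tangent_slope k]
   there; [k - 2/k] with [k = u + 1/u] is the absolute third moment of the
   standardized law on [{u, -1/u}]. *)
Definition tangent_slope k : R := k ^+ 3 / ((k ^+ 2 + 2) * Num.sqrt (k ^+ 2 - 4)).

(** A slope [l > 1] lets [l |x|] outweigh any 1-Lipschitz function, which later yields strict
    monotonicity on each half-line. *)
Lemma tangent_slope_gt1 k : 2 < k -> 1 < tangent_slope k.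
Proof.
move=> k2; rewrite /tangent_slope.
have K0 : 0 < k ^+ 2 - 4 by nra.
have s0 : 0 < Num.sqrt (k ^+ 2 - 4) by rewrite sqrtr_gt0.
have ss := sqr_sqrtr (ltW K0).
set s := Num.sqrt _ in s0 ss *.
rewrite ltr_pdivlMr ?mul1r; last by apply: mulr_gt0 => //; nra.
rewrite -(ltr_pXn2r (n := 2))//; last 2 first.
- by rewrite nnegrE mulr_ge0//; nra.
- by rewrite nnegrE exprn_ge0//; lra.
rewrite exprMn ss -subr_gt0.
have -> : (k ^+ 3) ^+ 2 - (k ^+ 2 + 2) ^+ 2 * (k ^+ 2 - 4) = 12 * k ^+ 2 + 16 by ring.
nra.
Qed.

(** This is the tangent inequality of [B] at [k - 2/k], evaluated at [m - 2/m]. Instead of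
    concavity, a computation: after clearing denominators and squaring, the gap is [(m - k)^2] times
    a nonnegative polynomial. *)
Lemma sqrt_tangent_le k m : 2 < k -> 2 <= m ->
  Num.sqrt (m ^+ 2 - 4) <=
  Num.sqrt (k ^+ 2 - 4) + tangent_slope k * ((m - 2 / m) - (k - 2 / k)).
Proof.
move=> k2 m2; rewrite /tangent_slope.
have K0 : 0 < k ^+ 2 - 4 by nra.
have s0 : 0 < Num.sqrt (k ^+ 2 - 4) by rewrite sqrtr_gt0.
have ss := sqr_sqrtr (ltW K0).
set s := Num.sqrt (k ^+ 2 - 4) in s0 ss *.
have M0 : 0 <= m ^+ 2 - 4 by nra.
have t0 := sqrtr_ge0 (m ^+ 2 - 4).
have tt := sqr_sqrtr M0.
set t := Num.sqrt _ in t0 tt *.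
pose N := k ^+ 3 * (m ^+ 2 - 2) - 8 * m.
have k20 : 0 < k ^+ 2 + 2 by nra.
have c0 : 0 < m * (k ^+ 2 + 2) by apply: mulr_gt0; lra.
rewrite (_ : s + _ = N / (s * (m * (k ^+ 2 + 2)))); last first.
  rewrite [X in X + _](_ : s = s ^+ 2 / s); last by field; rewrite gt_eqF.
  have [m0 k0] : 0 < m /\ 0 < k by lra.
  by rewrite ss /N; field; rewrite !gt_eqF.
rewrite ler_pdivlMr; last by rewrite mulr_gt0.
have N0 : 0 <= N.
  have k3 : 8 <= k ^+ 3 by rewrite (_ : 8 = 2 ^+ 3 :> R); [rewrite lerXn2r ?nnegrE; lra|ring].
  have m22 : 0 <= m ^+ 2 - 2 by nra.
  have : 0 <= (k ^+ 3 - 8) * (m ^+ 2 - 2) by rewrite mulr_ge0// subr_ge0.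
  by rewrite /N; nra.
rewrite -(ler_pXn2r (n := 2)) ?nnegrE//; last first.
  by rewrite mulr_ge0// mulr_ge0 ?(ltW s0)// ltW.
rewrite !exprMn tt ss -subr_ge0.
have -> : N ^+ 2 - (m ^+ 2 - 4) * ((k ^+ 2 - 4) * (m ^+ 2 * (k ^+ 2 + 2) ^+ 2)) =
  4 * (m - k) ^+ 2 * (k ^+ 2 * (3 * m ^+ 2 + 2 * m * k + k ^+ 2) +
                      4 * m * (m + 2 * k)) by rewrite /N; ring.
have [m0 k0] : 0 <= m /\ 0 <= k by lra.
have mk : 0 <= m * k by rewrite mulr_ge0.
apply: mulr_ge0; first by rewrite mulr_ge0 ?sqr_ge0.
apply: addr_ge0; first by apply: mulr_ge0; nra.
by apply: mulr_ge0; lra.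
Qed.

Lemma dist_inv_sqrt u : 0 < u ->
  `|u - u^-1| = Num.sqrt ((u + u^-1) ^+ 2 - 4).
Proof.
move=> u0; rewrite -sqrtr_sqr; congr Num.sqrt.
by field; rewrite gt_eqF.
Qed.

Lemma add_inv_ge2 u : 0 < u -> 2 <= u + u^-1.
Proof.
move=> u0; rewrite -subr_ge0 (_ : _ - _ = (u - 1) ^+ 2 / u); last first.
  by field; rewrite gt_eqF.
by rewrite divr_ge0 ?sqr_ge0// ltW.
Qed.

Lemma std_two_point_mean_norm_cube u : 0 < u ->
  std_two_point_mean (fun x => `|x| ^+ 3) u = u + u^-1 - 2 / (u + u^-1).
Proof.
move=> u0; rewrite /std_two_point_mean normrN !gtr0_norm ?invr_gt0//.
have := add_inv_ge2 u0; have : u * u^-1 = 1 by rewrite mulfV// gt_eqF.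
by move=> ? ?; field; rewrite !gt_eqF//=; nra.
Qed.

End two_point_extremality.

(** * Existence of a quadratic that touches [f - l |x|^3 / 6] from above at two points *)

Section quadratic_majorant.
Context {R : realType}.
Implicit Types (f D : R -> R) (k u x y : R).

Lemma is_derive_opp_inv u : u != 0 -> is_derive u 1 (fun t : R => - t^-1) (u ^- 2).
Proof.
move=> u0; have dV := is_deriveV u0 (is_derive_id u 1).
apply: (@is_derive_eq _ _ _ _ _ _ _ _ (is_deriveN dV)).
by rewrite /GRing.scale/= mulr1 opprK.
Qed.

(** If [D] has a double zero at [u] and a zero at [-1/u], only the last term of the derivative
    survives; this carries tangency from [u] over to [-1/u]. *)
Lemma is_derive_two_point_sum D (D1 : R -> R) u :
  (forall x, is_derive x 1 D (D1 x)) -> u != 0 ->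
  is_derive u 1 (fun t : R => D t + t ^+ 2 * D (- t^-1))
    (D1 u + 2 * u * D (- u^-1) + D1 (- u^-1)).
Proof.
move=> dD u0; have dV := is_derive_opp_inv u0.
have dDV := is_derive1_comp (f := D) (g := fun t => - t^-1) (dD _) dV.
apply: is_derive_eq.
by rewrite /GRing.scale/=; field.
Qed.

(** Compactness gives a maximum on [[1/M, M]]. Outside this interval [u + 1/u > M], so the values
    there are dominated by the one at 1, a point of the interval. *)
Lemma std_two_point_mean_max f (f1 : R -> R) (M : R) :
  (forall x, is_derive x 1 f (f1 x)) -> 1 <= M ->
  (forall u, 0 < u -> M < u + u^-1 ->
    std_two_point_mean f u <= std_two_point_mean f 1) ->
  exists2 u : R, 0 < u & forall t : R, 0 < t ->
    std_two_point_mean f t <= std_two_point_mean f u.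
Proof.
move=> df M1 fM.
have M0 : 0 < M by lra.
have VM1 : M^-1 <= 1 by rewrite invf_le1.
have VM0 : 0 < M^-1 by rewrite invr_gt0.
have [|u] := @EVT_max R (std_two_point_mean f) M^-1 M (le_trans VM1 M1).
  apply: derivable_within_continuous => t; rewrite in_itv/= => /andP[Mt _].
  have t0 : t != 0 by rewrite gt_eqF//; lra.
  have t20 : 1 + t ^+ 2 != 0 by rewrite gt_eqF//; nra.
  have d := is_derive_two_point_sum df t0.
  rewrite /std_two_point_mean; apply: derivableM; first by case: d.
  by apply: derivableV.
rewrite in_itv/= => /andP[Mu uM] umax.
have u_max t : M^-1 <= t <= M -> std_two_point_mean f t <= std_two_point_mean f u.
  by move=> tM; apply: umax; rewrite in_itv.
exists u; first exact: lt_le_trans Mu.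
move=> t t0; have tV0 : 0 < t^-1 by rewrite invr_gt0.
have [tM|Mt] := leP t M; last first.
  by rewrite (le_trans (fM _ t0 _)) ?u_max ?VM1//; lra.
have [Mt|tM'] := leP M^-1 t; first by rewrite u_max// Mt.
rewrite (le_trans (fM _ t0 _)) ?u_max ?VM1//.
suff : M < t^-1 by lra.
by rewrite -[M]invrK ltf_pV2.
Qed.

(** Under every standardized law the quadratic has mean [a + c], hence the form of the second
    conclusion: its right side adds to [sym_mean f] a sixth of the intercept of the tangent of [B]
    at [k - 2/k]. *)
Lemma cubic_quadratic_majorant f (f1 f2 : R -> R) k :
  (forall x, is_derive x 1 f (f1 x)) -> (forall x, is_derive x 1 f1 (f2 x)) ->
  (forall x y, `|f2 x - f2 y| <= `|x - y|) -> 2 < k ->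
  exists a b c,
    (forall x, f x <= a + b * x + c * x ^+ 2 + tangent_slope k / 6 * `|x| ^+ 3) /\
    a + c <= sym_mean f +
      (Num.sqrt (k ^+ 2 - 4) - tangent_slope k * (k - 2 / k)) / 6.
Proof.
move=> df df1 f2lip k2.
have l1 := tangent_slope_gt1 k2; set l := tangent_slope k in l1 *.
pose F x := f x - l / 6 * `|x| ^+ 3.
pose F1 x := f1 x - l / 2 * (x * `|x|).
pose F2 x := f2 x - l * `|x|.
have dF x : is_derive x 1 F (F1 x).
  have := is_derive_norm_cube x => ?; rewrite /F.
  by apply: is_derive_eq; rewrite /F1 /GRing.scale/=; field.
have dF1 x : is_derive x 1 F1 (F2 x).
  have := is_derive_mul_norm x => ?; rewrite /F1.
  by apply: is_derive_eq; rewrite /F2 /GRing.scale/=; field.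
have meanF u : 0 < u -> std_two_point_mean F u =
    std_two_point_mean f u - l / 6 * (u + u^-1 - 2 / (u + u^-1)).
  by move=> u0; rewrite -std_two_point_mean_norm_cube// /std_two_point_mean /F; ring.
have meanF1 : std_two_point_mean F 1 = sym_mean f - l / 6.
  by rewrite meanF// invr1 /std_two_point_mean /sym_mean invr1 expr1n; field.
have meanF_le u : 0 < u -> std_two_point_mean F u <= sym_mean f +
    `|u - u^-1| / 6 - l / 6 * (u + u^-1 - 2 / (u + u^-1)).
  move=> u0; rewrite meanF//.
  by have := std_two_point_mean_sub_le df df1 f2lip u0; lra.
have [u u0 u_max] : exists2 u : R, 0 < u & forall t : R, 0 < t ->
    std_two_point_mean F t <= std_two_point_mean F u.
  have l10 : 0 < l - 1 by lra.
  (* With [m = u + 1/u], the bounds [|u - 1/u| <= m] and [2/m <= 1] bring the mean at [u] below the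
     mean at 1 once [(l - 1) m >= 2 l]. *)
  have M1 : 1 <= 2 * l / (l - 1) by rewrite ler_pdivlMr//; lra.
  apply: (std_two_point_mean_max dF M1) => u u0 uM.
  rewrite meanF1 (le_trans (meanF_le _ u0))//.
  have uV0 : 0 < u^-1 by rewrite invr_gt0.
  have m2 := add_inv_ge2 u0.
  move: uM; rewrite ltr_pdivrMr// => uM.
  have d_le : `|u - u^-1| <= u + u^-1 by rewrite ler_norml; apply/andP; split; lra.
  have : 2 / (u + u^-1) <= 1 by rewrite ler_pdivrMr ?mul1r//; lra.
  set q := 2 / _; set m := u + _ in uM d_le *; nra.
pose v := - u^-1.
have v0 : v < 0 by rewrite /v oppr_lt0 invr_gt0.
have uv : u * v = -1 by rewrite /v mulrN mulfV// gt_eqF.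
(* Hermite interpolation: the quadratic agrees with [F] to first order at [u] and in value at [v].
   Tangency at [v] is left to the choice of [u]. *)
pose c := (F v - F u - F1 u * (v - u)) / (v - u) ^+ 2.
pose b := F1 u - 2 * c * u.
pose a := F u - b * u - c * u ^+ 2.
have vu : v - u != 0 by rewrite lt_eqF//; lra.
pose D x := a + b * x + c * x ^+ 2 - F x.
pose D1 x := b + 2 * c * x - F1 x.
pose D2 x := 2 * c - F2 x.
have dD x : is_derive x 1 D (D1 x).
  by rewrite /D; apply: is_derive_eq; rewrite /D1 /GRing.scale/=; ring.
have dD1 x : is_derive x 1 D1 (D2 x).
  by rewrite /D1; apply: is_derive_eq; rewrite /D2 /GRing.scale/=; ring.
have Du : D u = 0 by rewrite /D /a; ring.
have D1u : D1 u = 0 by rewrite /D1 /b; ring.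
have Dv : D v = 0 by rewrite /D /a /b /c; field.
have Dsum (t : R) : 0 < t -> D t + t ^+ 2 * D (- t^-1) =
    (1 + t ^+ 2) * (a + c - std_two_point_mean F t).
  move=> t0; rewrite /D /std_two_point_mean; field.
  by rewrite !gt_eqF//; nra.
have ac : a + c = std_two_point_mean F u.
  have := Dsum u u0; rewrite -/v Du Dv mulr0 addr0 => /esym/eqP.
  by rewrite mulf_eq0 subr_eq0 gt_eqF/=; [move/eqP|nra].
(* By [Dsum] and maximality of [u], the function [D t + t^2 D(-1/t)] is nonnegative for [t > 0] and
   vanishes at [u]. Its derivative at this minimum is 0, and it reduces to [D1 v]. *)
have D1v : D1 v = 0.
  have dH (t : R) : 0 < t -> is_derive t 1 (fun t : R => D t + t ^+ 2 * D (- t^-1))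
      (D1 t + 2 * t * D (- t^-1) + D1 (- t^-1)).
    by move=> t0; apply: is_derive_two_point_sum; rewrite ?gt_eqF.
  have d0 : is_derive u 1 (fun t : R => D t + t ^+ 2 * D (- t^-1)) 0.
    apply: (@derive1_at_min _ _ 0 (u + 1)); first by lra.
    - by move=> t; rewrite in_itv/= => /andP[t0 _]; case: (dH _ t0).
    - by rewrite in_itv/= u0/=; lra.
    - move=> t; rewrite in_itv/= => /andP[t0 _].
      rewrite -/v Du Dv mulr0 addr0 Dsum// mulr_ge0//; first nra.
      by rewrite subr_ge0 ac u_max.
  case: (dH _ u0) => _; case: d0 => _ -> .
  by rewrite -/v Dv D1u mulr0 !add0r.
exists a, b, c; split=> [x|].
  suff : 0 <= D x by rewrite /D /F; lra.
  (* Here [D2 = 2 c - f2 + l |x|], so the required strict monotonicity follows from [l > 1] and the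
     Lipschitz bound on [f2]. *)
  apply: (double_zeros_ge0 dD dD1 _ _ v0 u0) => // {}x y xy.
    move=> x0; rewrite /D2 /F2 !ger0_norm//; last lra.
    have := f2lip y x; rewrite ler_norml [`|y - x|]ger0_norm ?subr_ge0 ?(ltW xy)//.
    by move=> /andP[]; nra.
  move=> y0; rewrite /D2 /F2 !ler0_norm//; last lra.
  have := f2lip y x; rewrite ler_norml [`|y - x|]ger0_norm ?subr_ge0 ?(ltW xy)//.
  by move=> /andP[]; nra.
rewrite ac (le_trans (meanF_le _ u0))// dist_inv_sqrt//.
by have := sqrt_tangent_le k2 (add_inv_ge2 u0); rewrite -/l; lra.
Qed.

End quadratic_majorant.

(** * Integrability under cubic growth, and Fubini for real-valued integrals *)

Section cubic_integrability.
Context {R : realType}.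
Implicit Types (P Q : law R) (f g h : R -> R).

Lemma integrable_cubic_growth P f (C : R) :
  P.-integrable setT (fun x : R => (`|x| ^+ 3)%:E) -> measurable_fun setT f ->
  (forall x, `|f x| <= C * (1 + `|x| ^+ 3)) -> P.-integrable setT (EFin \o f).
Proof.
move=> iP mf fC.
apply: (le_integrable measurableT (g :=
  fun x : R => (C%:E * (1%:E + (`|x| ^+ 3)%:E))%E)).
- exact/measurable_EFinP.
- by move=> x _ /=; rewrite lee_fin (le_trans (fC x))// ler_norm.
- apply: integrableZl => //; apply: integrableD => //.
  exact: (finite_measure_integrable_cst P 1).
Qed.

Lemma integrable_pow P n : (n <= 3)%N ->
  P.-integrable setT (fun x : R => (`|x| ^+ 3)%:E) ->
  P.-integrable setT (fun x : R => (x ^+ n)%:E).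
Proof.
move=> n3 iP; apply: (integrable_cubic_growth (C := 1)) => //.
move=> x; rewrite mul1r normrX.
have x0 := normr_ge0 x; have [x1|x1] := leP `|x| 1.
  by rewrite (le_trans (exprn_ile1 n x0 x1))// lerDl exprn_ge0.
by rewrite (le_trans (ler_weXn2l (ltW x1) n3))// lerDr.
Qed.

Lemma integrable_prod_mul P Q g h :
  P.-integrable setT (EFin \o g) -> Q.-integrable setT (EFin \o h) ->
  (P \x Q)%E.-integrable setT (fun z : R * R => (g z.1 * h z.2)%:E).
Proof.
move=> ig ih.
have mg : measurable_fun setT g by apply/measurable_EFinP; exact: measurable_int ig.
have mh : measurable_fun setT h by apply/measurable_EFinP; exact: measurable_int ih.
apply/integrable12ltyP.
  apply/measurable_EFinP; apply: measurable_funM => //.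
    exact: measurableT_comp.
  exact: measurableT_comp.
under eq_integral => x _.
  under eq_integral do rewrite /= normrM EFinM.
  rewrite ge0_integralZl//; last first.
    by apply/measurable_EFinP; apply: measurableT_comp.
  over.
move: ig ih => /integrableP[_ ig] /integrableP[_ ih].
rewrite ge0_integralZr//; last 2 first.
- by apply/measurable_EFinP; apply: measurableT_comp.
- exact: integral_ge0.
by rewrite lte_mul_pinfty// ?integral_ge0// ge0_fin_numE// integral_ge0.
Qed.

(** Integrability of every section ensures that the inner real integral agrees with the extended one
    at each point, so [fine] loses nothing. *)
Lemma Rintegral_prod P Q (f : R * R -> R) :
  (P \x Q)%E.-integrable setT (EFin \o f) ->
  (forall x, Q.-integrable setT (fun y : R => (f (x, y))%:E)) ->
  P.-integrable setT (fun x : R => (\int[Q]_y f (x, y))%:E) /\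
  \int[(P \x Q)%E]_z f z = \int[P]_x \int[Q]_y f (x, y).
Proof.
move=> iPQ iQ.
have FE x : fubini_F Q (EFin \o f) x = (\int[Q]_y f (x, y))%:E.
  by rewrite /fubini_F /Rintegral fineK// integrable_fin_num.
have FE' : fubini_F Q (EFin \o f) = fun x : R => (\int[Q]_y f (x, y))%:E.
  exact/funext.
split; first by rewrite -FE'; exact: integrable_fubini_F.
rewrite [LHS]/Rintegral -(@integral12_prod_meas1 _ _ _ _ _ P Q)//.
by rewrite FE'.
Qed.

Lemma Rintegral_prod_swap P Q (f : R * R -> R) :
  (P \x Q)%E.-integrable setT (EFin \o f) ->
  (forall x, Q.-integrable setT (fun y : R => (f (x, y))%:E)) ->
  (forall y, P.-integrable setT (fun x : R => (f (x, y))%:E)) ->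
  measurable_fun setT (fun y : R => \int[P]_x f (x, y)) /\
  \int[P]_x \int[Q]_y f (x, y) = \int[Q]_y \int[P]_x f (x, y).
Proof.
move=> iPQ iQ iP.
have GE' : fubini_G P (EFin \o f) = fun y : R => (\int[P]_x f (x, y))%:E.
  apply/funext => y.
  by rewrite /fubini_G /Rintegral fineK// integrable_fin_num// iP.
have [_ <-] := Rintegral_prod iPQ iQ.
split.
  by apply/measurable_EFinP; move: (measurable_fubini_G iPQ); rewrite GE'.
rewrite [LHS]/Rintegral -(@integral21_prod_meas1 _ _ _ _ _ P Q)//.
by rewrite GE'.
Qed.

Lemma integrable_convolution P Q f : measurable_fun setT f ->
  (P \x Q)%E.-integrable setT (fun z : R * R => (f (z.1 + z.2))%:E) ->
  (convolution P Q).-integrable setT (EFin \o f) /\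
  \int[convolution P Q]_x f x = \int[(P \x Q)%E]_z f (z.1 + z.2).
Proof.
move=> mf iPQ; have mf' : measurable_fun setT (EFin \o f) by exact/measurable_EFinP.
split.
  exact: (integrable_pushforward measurable_addition mf' iPQ measurableT).
rewrite /Rintegral; congr fine.
exact: (@integral_distribution _ _ _ _ _ (prod_law P Q) addition).
Qed.

Lemma Rintegral_prod_mul P Q g h :
  P.-integrable setT (EFin \o g) -> Q.-integrable setT (EFin \o h) ->
  \int[(P \x Q)%E]_z (g z.1 * h z.2) = (\int[P]_x g x) * (\int[Q]_y h y).
Proof.
move=> ig ih.
have [|_ ->] := Rintegral_prod (integrable_prod_mul ig ih).
  by move=> x; exact: (integrableZl measurableT (g x) ih).
rewrite -RintegralZr//; apply: eq_Rintegral => x _ /=.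
exact: RintegralZl.
Qed.

End cubic_integrability.

(** * Moments about the mean up to order 3 *)

Section central_moments.
Context {R : realType}.
Implicit Types (P Q : law R) (f g h : R -> R).

Lemma norm_add_cube (x y : R) : `|x + y| ^+ 3 <= 4 * (`|x| ^+ 3 + `|y| ^+ 3).
Proof.
have x0 := normr_ge0 x; have y0 := normr_ge0 y.
apply: (@le_trans _ _ ((`|x| + `|y|) ^+ 3)).
  by rewrite lerXn2r ?nnegrE ?addr_ge0// ler_normD.
rewrite -subr_ge0 (_ : _ - _ = 3 * (`|x| + `|y|) * (`|x| - `|y|) ^+ 2); last by ring.
by rewrite mulr_ge0 ?sqr_ge0// mulr_ge0// addr_ge0.
Qed.

Lemma integrable_shifted_cubic_growth P f (c C : R) :
  P.-integrable setT (fun x : R => (`|x| ^+ 3)%:E) -> measurable_fun setT f ->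
  (forall x, `|f x| <= C * (1 + `|x - c| ^+ 3)) ->
  P.-integrable setT (EFin \o f).
Proof.
move=> iP mf fC.
have C0 : 0 <= C.
  by have := le_trans (normr_ge0 _) (fC c); rewrite subrr normr0 expr0n/= addr0 mulr1.
(* The constant comes from [|x - c|^3 <= 4 (|x|^3 + |c|^3)]. *)
apply: (@integrable_cubic_growth _ P f (C * (4 + 4 * `|c| ^+ 3))) => // x.
apply: (le_trans (fC x)); rewrite -mulrA ler_wpM2l//.
have := norm_add_cube x (- c); rewrite normrN.
have : 0 <= `|x| ^+ 3 by rewrite exprn_ge0.
have : 0 <= `|c| ^+ 3 by rewrite exprn_ge0.
by nra.
Qed.

Lemma integrable_central_pow P (c : R) n : (n <= 3)%N ->
  P.-integrable setT (fun x : R => (`|x| ^+ 3)%:E) ->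
  P.-integrable setT (fun x : R => ((x - c) ^+ n)%:E).
Proof.
move=> n3 iP; apply: (integrable_shifted_cubic_growth (c := c) (C := 1)) => //.
  by apply: measurable_funX; exact: measurable_funB.
move=> x; rewrite mul1r normrX; set y := `|x - c|.
have y0 : 0 <= y by exact: normr_ge0.
have [y1|y1] := leP y 1.
  by rewrite (le_trans (exprn_ile1 n y0 y1))// lerDl exprn_ge0.
by rewrite (le_trans (ler_weXn2l (ltW y1) n3))// lerDr.
Qed.

(** The numbers [m], [v], [t] are the first three cumulants; this choice makes them additive under
    convolution. *)
Definition central_moments P (m v t : R) :=
  [/\ P.-integrable setT (fun x : R => (`|x| ^+ 3)%:E),
      \int[P]_x (x - m) = 0,
      \int[P]_x (x - m) ^+ 2 = v &
      \int[P]_x (x - m) ^+ 3 = t].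

Lemma Rintegral_law_cst P (c : R) : \int[P]_x (cst c) x = c.
Proof. by rewrite Rintegral_cst// [X in fine X]probability_setT mulr1. Qed.

Lemma meanE P : mean P = \int[P]_x x.
Proof. by rewrite /mean unlock. Qed.

Lemma variance_idfunE P : 'V_P[idfun] = (\int[P]_x ((x - mean P) ^+ 2)%:E)%E.
Proof. by rewrite /variance /mean !unlock. Qed.

Lemma stddevE P : stddev P = Num.sqrt (\int[P]_x (x - mean P) ^+ 2).
Proof. by rewrite /stddev variance_idfunE. Qed.

Lemma rho3E P : rho3 P = \int[P]_x `|(x - mean P) / stddev P| ^+ 3.
Proof. by rewrite /rho3 unlock. Qed.

Lemma centred_moment3E P : centred_moment3 P = \int[P]_x (x - mean P) ^+ 3.
Proof. by rewrite /centred_moment3 unlock. Qed.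

Lemma Rintegral_central1 P (c : R) :
  P.-integrable setT (fun x : R => (`|x| ^+ 3)%:E) ->
  \int[P]_x (x - c) = \int[P]_x x - c.
Proof.
move=> iP; rewrite RintegralB//.
- by rewrite [X in _ - X](Rintegral_law_cst P c).
- exact: (integrable_pow (n := 1)).
- exact: (finite_measure_integrable_cst P c).
Qed.

Lemma central_moments_mean P m v t : central_moments P m v t -> mean P = m.
Proof.
move=> [iP Pm _ _]; rewrite meanE; apply/eqP; rewrite -subr_eq0.
by rewrite -Rintegral_central1// Pm.
Qed.

Lemma central_moments_stddev P m v t :
  central_moments P m v t -> stddev P = Num.sqrt v.
Proof.
by move=> Pm; rewrite stddevE (central_moments_mean Pm); case: Pm => _ _ ->.
Qed.

Lemma P3_integrable P : P3 P ->
  P.-integrable setT (fun x : R => (`|x| ^+ 3)%:E).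
Proof.
move=> [iP _]; apply/integrableP; split.
  by apply/measurable_EFinP; apply: measurable_funX; exact: normr_measurable.
by under eq_integral do rewrite /= ger0_norm ?exprn_ge0//.
Qed.

Lemma P3_stddev_gt0 P : P3 P -> 0 < stddev P.
Proof.
move=> hP; have [_] := hP; rewrite variance_idfunE => V0; rewrite stddevE sqrtr_gt0 /Rintegral.
(* Finiteness of the variance matters here: [fine] would send an infinite one to 0. *)
rewrite fine_gt0// V0/= integrable_lty//.
by apply: integrable_central_pow => //; exact: P3_integrable.
Qed.

Lemma P3_central_moments P : P3 P ->
  central_moments P (mean P) (stddev P ^+ 2) (centred_moment3 P).
Proof.
move=> hP.
have iP := P3_integrable hP.
split => //.
- by rewrite Rintegral_central1// -meanE subrr.
- rewrite stddevE sqr_sqrtr//; apply: Rintegral_ge0 => x _; exact: sqr_ge0.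
- by rewrite centred_moment3E.
Qed.

Lemma integrable_bounded P f (M : R) : measurable_fun setT f ->
  (forall x, `|f x| <= M) -> P.-integrable setT (EFin \o f).
Proof.
move=> mf fM; apply: measurable_bounded_integrable => //.
  by rewrite [X in (X < _)%E]probability_setT ltry.
exists M; split; first exact: num_real.
by move=> y My x _ /=; rewrite (le_trans (fM x))// ltW.
Qed.

(** The linear term disappears because [m] is the mean. Setting coefficients to 0 also yields
    integrability of the single terms. *)
Lemma Rintegral_quadratic_cube P m v t (a b c l : R) : central_moments P m v t ->
  P.-integrable setT (fun x : R =>
    (a + b * (x - m) + c * (x - m) ^+ 2 + l * `|x - m| ^+ 3)%:E) /\
  \int[P]_x (a + b * (x - m) + c * (x - m) ^+ 2 + l * `|x - m| ^+ 3) =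
  a + c * v + l * \int[P]_x (`|x - m| ^+ 3).
Proof.
move=> [iP P1 P2 _].
have i0 := finite_measure_integrable_cst P a measurableT.
have i1 := integrable_central_pow m (isT : (1 <= 3)%N) iP.
have i2 := integrable_central_pow m (isT : (2 <= 3)%N) iP.
have i3 : P.-integrable setT (fun x : R => (`|x - m| ^+ 3)%:E).
  have := integrable_norm (integrable_central_pow m (isT : (3 <= 3)%N) iP).
  by apply: eq_integrable => // x _; rewrite /= normrX.
have bi1 := integrableZl measurableT b i1.
have ci2 := integrableZl measurableT c i2.
have li3 := integrableZl measurableT l i3.
have i01 := integrableD measurableT i0 bi1.
have i012 := integrableD measurableT i01 ci2.
have i0123 := integrableD measurableT i012 li3.
split; first exact: i0123.
rewrite [LHS](RintegralD measurableT i012 li3).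
rewrite [X in X + _](RintegralD measurableT i01 ci2).
rewrite [X in X + _ + _](RintegralD measurableT i0 bi1).
rewrite Rintegral_law_cst.
rewrite [X in _ + X + _ + _](RintegralZl _ measurableT i1).
rewrite [X in _ + X + _](RintegralZl _ measurableT i2).
rewrite [X in _ + X](RintegralZl _ measurableT i3).
rewrite [X in b * X](_ : _ = 0) ?mulr0 ?addr0 ?P2//.
Qed.

End central_moments.

(** * The bound for one law, standardized and then merely centred *)

Section single_law_bound.
Context {R : realType}.
Implicit Types (P Q : law R) (f g h : R -> R) (L M k : R).

(** Explicit derivatives as witnesses make affine substitution and scaling immediate; the constant
    [L] is kept free because a dilation by [a] multiplies it by [|a|^3]. *)
Definition lipschitz_second_derivative L f := exists f1 f2 : R -> R,
  [/\ forall x : R, is_derive x 1 f (f1 x),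
      forall x : R, is_derive x 1 f1 (f2 x) &
      forall x y, `|f2 x - f2 y| <= L * `|x - y|].

Lemma lipschitz_second_derivative_affine L f (a b : R) :
  lipschitz_second_derivative L f ->
  lipschitz_second_derivative (L * `|a| ^+ 3) (fun x : R => f (a * x + b)).
Proof.
move=> [f1 [f2 [df df1 f2L]]].
have da (x : R) : is_derive x 1 (fun x : R => a * x + b) a.
  by apply: is_derive_eq; rewrite /GRing.scale/=; ring.
exists (fun x : R => a * f1 (a * x + b)), (fun x : R => a ^+ 2 * f2 (a * x + b)); split.
- move=> x.
  have dc := is_derive1_comp (f := f) (g := fun x : R => a * x + b) (df _) (da x).
  by apply: (is_derive_eq dc); rewrite /GRing.scale/= mulrC.
- move=> x.
  have dc := is_derive1_comp (f := f1) (g := fun x : R => a * x + b) (df1 _) (da x).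
  rewrite (_ : (fun x : R => a * f1 _) = a *: (f1 \o (fun x : R => a * x + b)))//.
  by apply: is_derive_eq; rewrite /GRing.scale/=; ring.
- move=> x y; rewrite -mulrBr normrM normrX.
  apply: (@le_trans _ _ (`|a| ^+ 2 * (L * `|a * (x - y)|))).
    rewrite ler_wpM2l ?exprn_ge0// (le_trans (f2L _ _))//.
    by rewrite (_ : a * x + b - _ = a * (x - y))//; ring.
  by rewrite normrM le_eqVlt; apply/orP; left; apply/eqP; ring.
Qed.

Lemma lipschitz_second_derivative_scale L f (c : R) :
  lipschitz_second_derivative L f ->
  lipschitz_second_derivative (`|c| * L) (fun x : R => c * f x).
Proof.
move=> [f1 [f2 [df df1 f2L]]].
exists (fun x : R => c * f1 x), (fun x : R => c * f2 x); split.
- by move=> x; apply: is_derive_eq; rewrite /GRing.scale/= ; ring.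
- by move=> x; apply: is_derive_eq; rewrite /GRing.scale/= ; ring.
- by move=> x y; rewrite -mulrBr normrM -mulrA ler_wpM2l.
Qed.

Lemma lipschitz_second_derivative_measurable L f :
  lipschitz_second_derivative L f -> measurable_fun setT f.
Proof.
move=> [f1 [f2 [df _ _]]]; apply: continuous_measurable_fun => x.
by apply/differentiable_continuous/derivable1_diffP; case: (df x).
Qed.

(** For [z = |y|] the defect [z^3 - (3 z^2 - 1) / 2] equals [(z - 1)^2 (2 z + 1) / 2], and the
    subtracted term has mean 1 when [y] has variance 1. *)
Lemma rho3_ge1 P : P3 P -> 1 <= rho3 P.
Proof.
move=> hP; have s0 := P3_stddev_gt0 hP; have cP := P3_central_moments hP.
set s := stddev P in s0 cP *; set m := mean P in cP *.
have [iq _] := Rintegral_quadratic_cube (- 2^-1) 0 (3 / 2 / s ^+ 2) 0 cP.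
have [ic _] := Rintegral_quadratic_cube 0 0 0 (s ^- 3) cP.
have qE := (Rintegral_quadratic_cube (- 2^-1) 0 (3 / 2 / s ^+ 2) 0 cP).2.
have -> : 1 = - 2^-1 + (3 / 2 / s ^+ 2) * s ^+ 2 + 0 * \int[P]_x (`|x - m| ^+ 3).
  by rewrite mul0r addr0 divfK ?expf_neq0 ?gt_eqF//; field.
rewrite -qE rho3E -/s -/m.
have cE (x : R) : 0 + 0 * (x - m) + 0 * (x - m) ^+ 2 + s ^- 3 * `|x - m| ^+ 3 =
    `|(x - m) / s| ^+ 3.
  by rewrite normrM normfV (gtr0_norm s0); field; rewrite gt_eqF.
apply: le_Rintegral => //.
  by apply: eq_integrable ic => // x _; rewrite cE.
move=> x _; set y := (x - m) / s.
have -> : x - m = y * s by rewrite /y divfK// gt_eqF.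
rewrite (_ : _ + _ = (3 * `|y| ^+ 2 - 1) / 2).
  have := normr_ge0 y; set z := `|y| => z0.
  rewrite -subr_ge0 (_ : _ - _ = (z - 1) ^+ 2 * (2 * z + 1) / 2); last by field.
  by rewrite divr_ge0// mulr_ge0 ?sqr_ge0//; lra.
by rewrite real_normK ?num_real//; field; rewrite gt_eqF.
Qed.

(** The quadratic majorant is integrated. Each [k > 2] selects one tangent of [B]; the best choice
    is made afterwards. *)
Lemma standardized_mean_le P f M k : P3 P ->
  lipschitz_second_derivative 1 f -> (forall x, `|f x| <= M) -> 2 < k ->
  \int[P]_x f ((x - mean P) / stddev P) <= sym_mean f +
    (Num.sqrt (k ^+ 2 - 4) + tangent_slope k * (rho3 P - (k - 2 / k))) / 6.
Proof.
move=> hP lf fM k2; have [f1 [f2 [df df1 f2L]]] := lf.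
have f2lip x y : `|f2 x - f2 y| <= `|x - y| by rewrite -[leRHS]mul1r.
have [a [b [c [fq ac]]]] := cubic_quadratic_majorant df df1 f2lip k2.
have s0 := P3_stddev_gt0 hP; have cP := P3_central_moments hP.
rewrite rho3E; set s := stddev P in s0 cP *; set m := mean P in cP *.
set l := tangent_slope k in fq ac *.
have [iq qE] := Rintegral_quadratic_cube a (b / s) (c / s ^+ 2) (l / 6 / s ^+ 3) cP.
have -> : \int[P]_x (`|(x - m) / s| ^+ 3) = \int[P]_x (`|x - m| ^+ 3) / s ^+ 3.
  rewrite -RintegralZr//.
    by apply: eq_Rintegral => x _; rewrite normrM normfV (gtr0_norm s0) exprMn exprVn.
  have [ic _] := Rintegral_quadratic_cube 0 0 0 1 cP.
  by apply: eq_integrable ic => // x _; rewrite !mul0r !add0r mul1r.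
apply: (@le_trans _ _ (a + c / s ^+ 2 * s ^+ 2 +
    l / 6 / s ^+ 3 * \int[P]_x (`|x - m| ^+ 3))).
  rewrite -qE; apply: le_Rintegral => //.
    apply: integrable_bounded; last by move=> x; exact: fM.
    apply: measurableT_comp; first exact: lipschitz_second_derivative_measurable lf.
    exact: measurable_std_map.
  move=> x _; apply: (le_trans (fq _)).
  rewrite normrM normfV (gtr0_norm s0) le_eqVlt; apply/orP; left; apply/eqP.
  by field; rewrite gt_eqF.
rewrite divfK ?expf_neq0 ?gt_eqF//.
have -> : l / 6 / s ^+ 3 * \int[P]_x `|x - m| ^+ 3 =
  l * (\int[P]_x `|x - m| ^+ 3 / s ^+ 3) / 6 by ring.
by lra.
Qed.

(** At [rho = k - 2/k] the inner radicand [rho^2 + 8] is the square of [k + 2/k], which resolves the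
    nested root. *)
Lemma B_tangent k : 2 <= k -> B (k - 2 / k) = Num.sqrt (k ^+ 2 - 4).
Proof.
move=> k2; rewrite /B.
have -> : (k - 2 / k) ^+ 2 + 8 = (k + 2 / k) ^+ 2 by field; rewrite gt_eqF//; lra.
rewrite sqrtr_sqr ger0_norm; last by rewrite addr_ge0// ?divr_ge0//; lra.
by congr Num.sqrt; field; rewrite gt_eqF//; lra.
Qed.

Lemma rho_parametrization (r : R) : 1 <= r -> exists2 k, 2 <= k & r = k - 2 / k.
Proof.
move=> r1; pose q := Num.sqrt (r ^+ 2 + 8).
have q2 : q ^+ 2 = r ^+ 2 + 8 by rewrite sqr_sqrtr//; nra.
have q0 : 0 <= q by exact: sqrtr_ge0.
have q3 : 3 <= q by rewrite -(ler_pXn2r (n := 2)) ?nnegrE//; nra.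
(* The witness is the positive root of [k^2 - r k - 2 = 0]. *)
exists ((r + q) / 2); first lra.
have k0 : r + q != 0 by rewrite gt_eqF//; lra.
apply: (mulIf k0); rewrite mulrBl (_ : 2 / _ * (r + q) = 4); last by field.
by nra.
Qed.

Lemma standardized_mean_le_B P f M : P3 P ->
  lipschitz_second_derivative 1 f -> (forall x, `|f x| <= M) ->
  \int[P]_x f ((x - mean P) / stddev P) <= sym_mean f + B (rho3 P) / 6.
Proof.
move=> hP lf fM; have fle k := standardized_mean_le hP lf fM (k := k).
have [k k2 rk] := rho_parametrization (rho3_ge1 hP).
rewrite rk B_tangent//; move: k2; rewrite le_eqVlt => /predU1P[k2|k2]; last first.
  by have := fle _ k2; rewrite rk subrr mulr0 addr0.
(* [rho = 1]: the tangent slope is infinite, so let [k] decrease to [2]. *)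
rewrite -k2 (_ : 2 ^+ 2 - 4 = 0 :> R); last by ring.
rewrite sqrtr0 mul0r addr0 leNgt; apply/negP => flt.
pose e := \int[P]_x f ((x - mean P) / stddev P) - sym_mean f.
have e0 : 0 < e by rewrite subr_gt0.
(* This makes [sqrt (k'^2 - 4)] equal to the supposed excess [e], so the bound reads
   [e <= e / 6]. *)
pose k' := Num.sqrt (4 + e ^+ 2).
have k'2 : k' ^+ 2 = 4 + e ^+ 2 by rewrite sqr_sqrtr//; nra.
have k'0 : 0 <= k' by exact: sqrtr_ge0.
have lt2 : 2 < k' by rewrite -(ltr_pXn2r (n := 2)) ?nnegrE//; nra.
have := fle _ lt2; rewrite k'2 addrAC subrr add0r sqrtr_sqr gtr0_norm//.
rewrite rk -k2 mulfV// => fle'.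
have : tangent_slope k' * (2 - 1 - (k' - 2 / k')) <= 0.
  rewrite mulr_ge0_le0//; first by have := tangent_slope_gt1 lt2; lra.
  have : 2 / k' <= 1 by rewrite ler_pdivrMr; lra.
  by lra.
by move: fle'; rewrite -lerBlDl -/e; lra.
Qed.

Lemma centered_mean_le P f L M : P3 P -> 0 < L ->
  lipschitz_second_derivative L f -> (forall x, `|f x| <= M) ->
  \int[P]_x f (x - mean P) <= (f (stddev P) + f (- stddev P)) / 2 +
    L * (stddev P ^+ 3 * B (rho3 P)) / 6.
Proof.
move=> hP L0 lf fM; have s0 := P3_stddev_gt0 hP; set s := stddev P in s0 *.
(* Dilating by [s] multiplies the Lipschitz constant [L] by [s^3]; the factor [c] brings it back to
   1. *)
set c := (L * s ^+ 3)^-1; have c0 : 0 < c by rewrite invr_gt0 mulr_gt0// exprn_gt0.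
pose g x := c * f (s * x + 0).
have lg : lipschitz_second_derivative 1 g.
  have := lipschitz_second_derivative_scale c (lipschitz_second_derivative_affine s 0 lf).
  by rewrite !gtr0_norm// /c mulVf// gt_eqF// mulr_gt0// exprn_gt0.
have gM x : `|g x| <= c * M by rewrite /g normrM gtr0_norm// ler_pM2l.
have := standardized_mean_le_B hP lg gM; rewrite -/s.
rewrite (_ : \int[P]_x g _ = c * \int[P]_x f (x - mean P)); last first.
  rewrite -RintegralZl//.
    by apply: eq_Rintegral => x _; rewrite /g addr0 [s * _]mulrC divfK ?gt_eqF.
  apply: (integrable_bounded _ (M := M)) => //.
  apply: measurableT_comp; first exact: lipschitz_second_derivative_measurable lf.
  exact: measurable_funB.
rewrite -ler_pdivlMl// => /le_trans; apply.
rewrite /sym_mean /g !addr0 mulr1 mulrN1 /c le_eqVlt; apply/orP; left; apply/eqP.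
by field; rewrite !gt_eqF.
Qed.

Lemma centered_mean_dist P f L M : P3 P -> 0 < L ->
  lipschitz_second_derivative L f -> (forall x, `|f x| <= M) ->
  `|\int[P]_x f (x - mean P) - (f (stddev P) + f (- stddev P)) / 2| <=
    L * (stddev P ^+ 3 * B (rho3 P)) / 6.
Proof.
move=> hP L0 lf fM; rewrite ler_norml; apply/andP; split; last first.
  by have := centered_mean_le hP L0 lf fM; lra.
have := lipschitz_second_derivative_scale (-1) lf.
rewrite normrN1 mul1r => lNf.
have NfM x : `|-1 * f x| <= M by rewrite mulN1r normrN.
have := centered_mean_le hP L0 lNf NfM.
rewrite RintegralZl//; first by lra.
apply: (integrable_bounded _ (M := M)) => //.
apply: measurableT_comp; first exact: lipschitz_second_derivative_measurable lf.
exact: measurable_funB.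
Qed.

End single_law_bound.

(** * Moments of convolutions, two-point integrals, and the exchange argument *)

Section convolution_integrals.
Context {R : realType}.
Implicit Types (P Q : law R) (f g h : R -> R) (L M : R).

Lemma Rintegral_bounded P f M : measurable_fun setT f ->
  (forall x, `|f x| <= M) -> `|\int[P]_x f x| <= M.
Proof.
move=> mf fM; have i := integrable_bounded P mf fM.
rewrite (le_trans (le_normr_Rintegral _ i))// -[leRHS](Rintegral_law_cst P).
apply: le_Rintegral => //; first exact: (integrable_norm i).
exact: (finite_measure_integrable_cst P M).
Qed.

Lemma Rintegral_dist_le P f g (e : R) :
  P.-integrable setT (EFin \o f) -> P.-integrable setT (EFin \o g) ->
  (forall x, `|f x - g x| <= e) -> `|\int[P]_x f x - \int[P]_x g x| <= e.
Proof.
move=> fi gi fge; rewrite -RintegralB//.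
apply: Rintegral_bounded => //; apply: measurable_funB.
- by apply/measurable_EFinP; exact: measurable_int fi.
- by apply/measurable_EFinP; exact: measurable_int gi.
Qed.

Lemma bounded_fubini P Q (F : R * R -> R) M : measurable_fun setT F ->
  (forall z, `|F z| <= M) ->
  [/\ P.-integrable setT (fun x : R => (\int[Q]_y F (x, y))%:E),
      Q.-integrable setT (fun y : R => (\int[P]_x F (x, y))%:E),
      \int[P]_x \int[Q]_y F (x, y) = \int[Q]_y \int[P]_x F (x, y) &
      (P \x Q)%E.-integrable setT (EFin \o F) /\
      \int[(P \x Q)%E]_z F z = \int[P]_x \int[Q]_y F (x, y)].
Proof.
move=> mF FM.
have iF : (P \x Q)%E.-integrable setT (EFin \o F).
  apply: measurable_bounded_integrable => //.
    by rewrite [X in (X < _)%E](prod_law_setT P Q) ltry.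
  exists M; split; first exact: num_real.
  by move=> y My z _ /=; rewrite (le_trans (FM z))// ltW.
have mF1 x : measurable_fun setT (fun y : R => F (x, y)).
  exact: measurableT_comp.
have mF2 y : measurable_fun setT (fun x : R => F (x, y)).
  exact: measurableT_comp.
have iQ x : Q.-integrable setT (fun y : R => (F (x, y))%:E).
  exact: (integrable_bounded Q (mF1 x) (fun y => FM (x, y))).
have iP y : P.-integrable setT (fun x : R => (F (x, y))%:E).
  exact: (integrable_bounded P (mF2 y) (fun x => FM (x, y))).
have [i1 e1] := Rintegral_prod iF iQ.
have [m2 e2] := Rintegral_prod_swap iF iQ iP.
split => //; apply: (integrable_bounded _ m2 (M := M)) => y.
exact: Rintegral_bounded.
Qed.

Lemma bounded_convolution P Q f M : measurable_fun setT f ->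
  (forall x, `|f x| <= M) ->
  \int[convolution P Q]_x f x = \int[P]_x \int[Q]_y f (x + y).
Proof.
move=> mf fM.
have mF : measurable_fun setT (fun z : R * R => f (z.1 + z.2)).
  apply: measurableT_comp => //; exact: measurable_addition.
have [_ _ _ [iF <-]] := bounded_fubini P Q mF (fun z => fM _).
by have [_ ->] := integrable_convolution mf iF.
Qed.

Lemma integrable_prod_norm_cube P Q :
  P.-integrable setT (fun x : R => (`|x| ^+ 3)%:E) ->
  Q.-integrable setT (fun x : R => (`|x| ^+ 3)%:E) ->
  (P \x Q)%E.-integrable setT (fun z : R * R => (`|z.1 + z.2| ^+ 3)%:E).
Proof.
move=> iP iQ.
have i1 := integrable_prod_mul iP (finite_measure_integrable_cst Q 1 measurableT).
have i2 := integrable_prod_mul (finite_measure_integrable_cst P 1 measurableT) iQ.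
apply: (le_integrable measurableT _ _
  (integrableZl measurableT 4 (integrableD measurableT i1 i2))).
  apply/measurable_EFinP; apply: measurable_funX; apply: measurableT_comp.
    exact: normr_measurable.
  exact: measurable_addition.
move=> z _; rewrite lee_fin/= ger0_norm ?exprn_ge0// mulr1 mul1r.
by rewrite (le_trans (norm_add_cube _ _))// ler_norm.
Qed.

Lemma Rintegral_sum d (T : measurableType d) (mu : {measure set T -> \bar R})
    n (F : 'I_n -> T -> R) :
  (forall i, mu.-integrable setT (EFin \o F i)) ->
  \int[mu]_z (\sum_(i < n) F i z) = \sum_(i < n) \int[mu]_z F i z.
Proof.
move=> iF; rewrite /Rintegral.
under eq_integral do rewrite -sumEFin.
rewrite integral_sum// sum_fine// => i _.
exact: (integrable_fin_num measurableT (iF i)).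
Qed.

(** Binomial expansion of [(x - c) + (y - d)], each product integrating to a product under the
    product law. *)
Lemma convolution_central_pow P Q (c d : R) k : (k <= 3)%N ->
  P.-integrable setT (fun x : R => (`|x| ^+ 3)%:E) ->
  Q.-integrable setT (fun x : R => (`|x| ^+ 3)%:E) ->
  \int[convolution P Q]_x (x - (c + d)) ^+ k =
  \sum_(i < k.+1) 'C(k, i)%:R *
    ((\int[P]_x (x - c) ^+ (k - i)) * \int[Q]_y (y - d) ^+ i).
Proof.
move=> k3 iP iQ.
have iPk i := integrable_central_pow c (leq_trans (leq_subr i k) k3) iP.
have iQk (i : 'I_k.+1) :=
  integrable_central_pow d (leq_trans (ltn_ord i : i <= k)%N k3) iQ.
have iF (i : 'I_k.+1) : (P \x Q)%E.-integrable setT (fun z : R * R =>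
    ('C(k, i)%:R * ((z.1 - c) ^+ (k - i) * (z.2 - d) ^+ i))%:E).
  exact: (integrableZl measurableT ('C(k, i)%:R) (integrable_prod_mul (iPk i) (iQk i))).
have FE (z : R * R) : (z.1 + z.2 - (c + d)) ^+ k =
    \sum_(i < k.+1) 'C(k, i)%:R * ((z.1 - c) ^+ (k - i) * (z.2 - d) ^+ i).
  rewrite (_ : z.1 + z.2 - (c + d) = (z.1 - c) + (z.2 - d)); last by ring.
  by rewrite exprDn; apply: eq_bigr => i _; rewrite mulr_natl.
have mk : measurable_fun setT (fun x : R => (x - (c + d)) ^+ k).
  by apply: measurable_funX; exact: measurable_funB.
have [|_ ->] := integrable_convolution (P := P) (Q := Q) mk.
  have := integrable_sum measurableT (index_enum 'I_k.+1) (P := xpredT)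
    (h := fun i (z : R * R) =>
      ('C(k, i)%:R * ((z.1 - c) ^+ (k - i) * (z.2 - d) ^+ i))%:E) (fun i _ => iF i).
  by apply: eq_integrable => // z _; rewrite sumEFin -FE.
under eq_Rintegral do rewrite FE.
rewrite Rintegral_sum//.
apply: eq_bigr => i _; rewrite RintegralZl//; last exact: integrable_prod_mul (iPk i) (iQk i).
by congr (_ * _); exact: (Rintegral_prod_mul (iPk i) (iQk i)).
Qed.

(** Up to order 3, every mixed term of the expansion contains a first central moment and so
    vanishes. *)
Lemma central_moments_convolution P Q (m v t m' v' t' : R) :
  central_moments P m v t -> central_moments Q m' v' t' ->
  central_moments (convolution P Q) (m + m') (v + v') (t + t').
Proof.
move=> [iP P1 P2 P3] [iQ Q1 Q2 Q3].
have E0 (P0 : law R) (c : R) : \int[P0]_x (x - c) ^+ 0 = 1.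
  by rewrite -[RHS](Rintegral_law_cst P0).
have E1 (P0 : law R) (c : R) : \int[P0]_x (x - c) ^+ 1 = \int[P0]_x (x - c) by [].
have pow k k3 := convolution_central_pow m m' (k := k) k3 iP iQ.
split.
- have m3 : measurable_fun setT (fun x : R => `|x| ^+ 3).
    by apply: measurable_funX; exact: normr_measurable.
  by have [] := integrable_convolution m3 (integrable_prod_norm_cube iP iQ).
- rewrite -E1 pow// !big_ord_recl big_ord0 /= !E0 !E1 P1 Q1; ring.
- rewrite pow// !big_ord_recl big_ord0 /= !E0 !E1 P1 Q1 P2 Q2.
  by rewrite bin0 (_ : 'C(2, bump 0 (bump 0 0)) = 1)%N//; ring.
- rewrite pow// !big_ord_recl big_ord0 /= !E0 !E1 P1 Q1 P2 Q2 P3 Q3.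
 by rewrite bin0 (_ : 'C(3, bump 0 (bump 0 (bump 0 0))) = 1)%N//; ring.
Qed.

Lemma integral_two_point P (a b p : R) f : 0 <= p <= 1 ->
  (forall A, measurable A -> P A = (p%:E * \d_a A + (1 - p)%:E * \d_b A)%E) ->
  measurable_fun setT f ->
  P.-integrable setT (EFin \o f) /\ \int[P]_x f x = p * f a + (1 - p) * f b.
Proof.
move=> /andP[p0 p1] PE mf; have q0 : 0 <= 1 - p by lra.
(* Nonnegative integrands come first; the absolute value then gives integrability, and positive and
   negative parts give the general formula. *)
have ge0 (g : R -> \bar R) : measurable_fun setT g -> (forall x, (0 <= g x)%E) ->
    (\int[P]_x g x = p%:E * g a + (1 - p)%:E * g b)%E.
  move=> mg g0.
  rewrite (eq_measure_integral
    (measure_add (mscale (NngNum p0) \d_a) (mscale (NngNum q0) \d_b))); last first.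
    by move=> A mA _; rewrite [RHS]measure_addE; exact: PE.
  rewrite ge0_integral_measure_add// !ge0_integral_mscale//.
  by rewrite !integral_dirac// !diracT !mul1e.
have mf' : measurable_fun setT (EFin \o f) by exact/measurable_EFinP.
split.
  have mabs : measurable_fun setT (fun x : R => `|(f x)%:E|)%E by exact: measurableT_comp.
  apply/integrableP; split=> //; rewrite ge0//=.
  by rewrite -!EFinM -EFinD ltry.
rewrite /Rintegral integralE !ge0//; [|exact: measurable_funeneg|exact: measurable_funepos].
rewrite !funeposE !funenegE /= -!EFin_max -!EFinM -!EFinD /=.
have maxB (y : R) : Num.max y 0 - Num.max (- y) 0 = y.
  by rewrite /Num.max; case: ifPn; case: ifPn; lra.
rewrite -[in RHS](maxB (f a)) -[in RHS](maxB (f b)); ring.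
Qed.

Lemma sym_two_pointE (s : R) A : measurable A ->
  sym_two_point s A = ((2^-1)%:E * \d_(- s)%R A + (1 - 2^-1)%:E * \d_s A)%E.
Proof.
move=> mA; rewrite (_ : sym_two_point s A =
  ((2^-1)%:E * measure_add \d_(- s)%R \d_s A)%E)// measure_addE.
rewrite ge0_muleDr// (_ : 1 - 2^-1 = 2^-1 :> R)//; lra.
Qed.

Lemma Rintegral_sym_two_point (s : R) f : measurable_fun setT f ->
  (sym_two_point s).-integrable setT (EFin \o f) /\
  \int[sym_two_point s]_x f x = (f s + f (- s)) / 2.
Proof.
move=> mf; have h2 : 0 <= (2^-1 : R) <= 1 by lra.
have [? ->] := integral_two_point h2 (sym_two_pointE s) mf.
by split=> //; field.
Qed.

Lemma central_moments_sym_two_point (s : R) :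
  central_moments (sym_two_point s) 0 (s ^+ 2) 0.
Proof.
have mX n : measurable_fun setT (fun x : R => (x - 0) ^+ n).
  by apply: measurable_funX; exact: measurable_funB.
have m3 : measurable_fun setT (fun x : R => `|x| ^+ 3).
  by apply: measurable_funX; exact: normr_measurable.
split.
- exact: (Rintegral_sym_two_point s m3).1.
- by rewrite [LHS](Rintegral_sym_two_point s (mX 1)).2; field.
- by rewrite (Rintegral_sym_two_point s (mX 2)).2; field.
- by rewrite (Rintegral_sym_two_point s (mX 3)).2; field.
Qed.

Lemma central_moments_dirac0 : central_moments (\d_(0 : R) : law R) 0 0 0.
Proof.
(* The point mass is read as a mixture with [p = 1] and coinciding atoms, so that
   [integral_two_point] applies. *)
have h : forall A, measurable A ->
    (\d_(0 : R) : law R) A = (1%:E * \d_(0 : R)%R A + (1 - 1)%:E * \d_(0 : R)%R A)%E.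
  by move=> A _; rewrite subrr mul0e adde0 mul1e.
have h01 : 0 <= (1 : R) <= 1 by rewrite ler01 lexx.
have mX n : measurable_fun setT (fun x : R => (x - 0) ^+ n).
  by apply: measurable_funX; exact: measurable_funB.
have m3 : measurable_fun setT (fun x : R => `|x| ^+ 3).
  by apply: measurable_funX; exact: normr_measurable.
split.
- exact: (integral_two_point h01 h m3).1.
- by rewrite [LHS](integral_two_point h01 h (mX 1)).2; ring.
- by rewrite (integral_two_point h01 h (mX 2)).2; ring.
- by rewrite (integral_two_point h01 h (mX 3)).2; ring.
Qed.

Lemma central_moments_convolutions n (P : 'I_n -> law R) (m v t : 'I_n -> R) :
  (forall i, central_moments (P i) (m i) (v i) (t i)) ->
  central_moments (convolutions P) (\sum_i m i) (\sum_i v i) (\sum_i t i).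
Proof.
move=> cP; rewrite /convolutions.
elim: (index_enum _) => [|i r IH]; first by rewrite !big_nil; exact: central_moments_dirac0.
by rewrite !big_cons; exact: central_moments_convolution.
Qed.

(* Lindeberg's exchange, one summand at a time; generality in [f] replaces
   the fact that convolving [f] with a law preserves the hypotheses. *)
Lemma convolutions_dist n (P : 'I_n -> law R) f L M :
  (forall i, P3 (P i)) -> 0 < L ->
  lipschitz_second_derivative L f -> (forall x, `|f x| <= M) ->
  `|\int[convolutions P]_x f (x - \sum_i mean (P i)) -
    \int[convolutions (fun i => sym_two_point (stddev (P i)))]_x f x| <=
  L * (\sum_i stddev (P i) ^+ 3 * B (rho3 (P i))) / 6.
Proof.
move=> hP L0; rewrite /convolutions.
elim: (index_enum _) f => [|i r IH] f lf fM.
  rewrite !big_nil mulr0 mul0r.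
  by under eq_Rintegral do rewrite subr0; rewrite subrr normr0.
rewrite !big_cons.
set CP := \big[convolution/_]_(j <- r) P j.
set CQ := \big[convolution/_]_(j <- r) _.
set m := \sum_(j <- r) mean _ in IH *; set bd := \sum_(j <- r) _ in IH *.
have mf := lipschitz_second_derivative_measurable lf.
have mfD (c : R) : measurable_fun setT (fun x : R => f (x - c)).
  by apply: measurableT_comp => //; exact: measurable_funB.
rewrite (bounded_convolution (M := M) _ _ (mfD _))//.
rewrite (bounded_convolution (M := M) _ _ mf)//.
have mF (c : R) : measurable_fun setT (fun z : R * R => f (z.1 + z.2 - c)).
  apply: (measurableT_comp (mfD c)); exact: measurable_addition.
have [iP1 _ _ _] := bounded_fubini (P i) CP (mF (mean (P i) + m)) (fun z => fM _).
have [iP2 iP2' swapP _] := bounded_fubini (P i) CQ (mF (mean (P i))) (fun z => fM _).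
have mF0 : measurable_fun setT (fun z : R * R => f (z.1 + z.2)).
  apply: (measurableT_comp mf); exact: measurable_addition.
have [_ iQ' swapQ _] := bounded_fubini (sym_two_point (stddev (P i))) CQ mF0
  (fun z => fM _).
have d1 := Rintegral_dist_le iP1 iP2 (e := L * bd / 6).
have d2 := Rintegral_dist_le iP2' iQ'
  (e := L * (stddev (P i) ^+ 3 * B (rho3 (P i))) / 6).
have lip_shift (c : R) : lipschitz_second_derivative L (fun x : R => f (1 * x + c)).
  by have := lipschitz_second_derivative_affine 1 c lf; rewrite normr1 expr1n mulr1.
rewrite [X in _ - X]swapQ mulrDr mulrDl [leRHS]addrC.
(* The intermediate term keeps [P i] but has the tail already exchanged. The tail is compared for
   fixed [x] by induction; the head for fixed [y], after swapping the integrals, by the single-law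
   bound. *)
apply: (le_trans (ler_distD (\int[P i]_x \int[CQ]_y f (x + y - mean (P i))) _ _)).
rewrite lerD//.
  apply: d1 => x.
  have := IH _ (lip_shift (x - mean (P i))) (fun y => fM _).
  congr (`| _ - _ | <= _); apply: eq_Rintegral => y _ /=; congr f; ring.
rewrite [X in `|X - _|]swapP; apply: d2 => y.
rewrite (_ : \int[sym_two_point _]_x _ =
    (f (1 * stddev (P i) + y) + f (1 * - stddev (P i) + y)) / 2); last first.
  have mfy : measurable_fun setT (fun x : R => f (x + y)).
    by apply: measurableT_comp => //; exact: measurable_funD.
  by have [_ ->] := Rintegral_sym_two_point (stddev (P i)) mfy; rewrite !mul1r.
have := centered_mean_dist (hP i) L0 (lip_shift y) (fun x => fM _).
congr (`| _ - _ | <= _); apply: eq_Rintegral => x _ /=; congr f; ring.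
Qed.
End convolution_integrals.

(** * Taylor bounds for sine and cosine, and the lower bound for [zeta3] by third moments *)

Section zeta3_lower_bound.
Context {R : realType}.
Implicit Types (P Q : law R) (f g h : R -> R) (L M x y : R).

Lemma derive_monomial_bound_pos h (h1 : R -> R) (C : R) n y :
  (forall x, is_derive x 1 h (h1 x)) -> h 0 = 0 ->
  (forall x, 0 <= x -> h1 x <= C * n.+1%:R * x ^+ n) ->
  0 <= y -> h y <= C * y ^+ n.+1.
Proof.
move=> dh h0 h1C y0.
pose g (x : R) := C * x ^+ n.+1 - h x.
pose g1 (x : R) := C * n.+1%:R * x ^+ n - h1 x.
have dg x : is_derive x 1 g (g1 x).
  have dX : is_derive x 1 (fun x : R => x ^+ n.+1) (n.+1%:R * x ^+ n).
    rewrite (_ : (fun x => _) = id ^+ n.+1); last by apply/funext => z; rewrite exprfctE.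
    by apply: is_derive_eq; rewrite /GRing.scale/= mulr1.
  rewrite /g; apply: is_derive_eq.
  by rewrite /g1 /GRing.scale/=; ring.
have := derive_ge0_le dg (a := 0) (b := y) _ y0.
rewrite /g h0 expr0n/= mulr0 subr0 => gy; rewrite -subr_ge0 gy// => x /andP[x0 _].
by rewrite subr_ge0 h1C// ltW.
Qed.

(** Integrating a bound on the derivative raises its order by one; iterated from [|cos| <= 1], this
    produces the Taylor remainders of sine and cosine in turn. *)
Lemma derive_monomial_bound h (h1 : R -> R) (C : R) n y :
  (forall x, is_derive x 1 h (h1 x)) -> h 0 = 0 ->
  (forall x, `|h1 x| <= C * n.+1%:R * `|x| ^+ n) ->
  `|h y| <= C * `|y| ^+ n.+1.
Proof.
wlog y0 : h h1 y / 0 <= y => [wlogH|].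
  have [y0|/ltW y0] := leP 0 y; first exact: (wlogH h h1).
  move=> dh h0 h1C.
  have := wlogH (fun x => h (- x)) (fun x => - h1 (- x)) (- y).
  rewrite opprK normrN oppr0; apply => //.
  - by rewrite oppr_ge0.
  - by move=> x; apply: is_derive_eq; rewrite /GRing.scale/=; ring.
  - by move=> x; rewrite normrN -[`|x|]normrN.
move=> dh h0 h1C; rewrite ler_norml [`|y|]ger0_norm//; apply/andP; split.
  rewrite lerNl; apply: (@derive_monomial_bound_pos (fun x => - h x) (fun x => - h1 x)) => //.
  - by rewrite h0 oppr0.
  - by move=> x x0; have := h1C x; rewrite ler_norml [`|x|]ger0_norm// lerNl => /andP[].
apply: (derive_monomial_bound_pos dh) => // x x0.
by have := h1C x; rewrite ler_norml [`|x|]ger0_norm// => /andP[].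
Qed.

Lemma sin_norm_le x : `|sin x| <= `|x|.
Proof.
have := @derive_monomial_bound sin cos 1 0 x (@is_derive_sin R) (sin0 R).
move=> H; rewrite -[leRHS]mul1r; apply: H => t.
by rewrite expr0 !mulr1; exact: cos_max.
Qed.

Lemma cos_taylor2 x : `|cos x - 1| <= 2^-1 * `|x| ^+ 2.
Proof.
apply: (derive_monomial_bound (h := fun t => cos t - 1) (h1 := fun t => - sin t)).
- by move=> t; apply: is_derive_eq; rewrite subr0.
- by rewrite cos0 subrr.
- by move=> t; rewrite normrN mulVf// mul1r sin_norm_le.
Qed.

Lemma sin_taylor3 x : `|sin x - x| <= 6^-1 * `|x| ^+ 3.
Proof.
apply: (derive_monomial_bound (h := fun t => sin t - t) (h1 := fun t => cos t - 1)).
- by rewrite sin0 subrr.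
- by move=> t; rewrite (_ : 6^-1 * 3%:R = 2^-1) ?cos_taylor2//; field.
Qed.

Lemma cos_taylor4 x : `|cos x - 1 + 2^-1 * x ^+ 2| <= 24^-1 * `|x| ^+ 4.
Proof.
apply: (derive_monomial_bound (h := fun t => cos t - 1 + 2^-1 * t ^+ 2)
  (h1 := fun t => - (sin t - t))).
- by move=> t; apply: is_derive_eq; rewrite /GRing.scale/=; field.
- by rewrite cos0 subrr expr0n/= mulr0 addr0.
- by move=> t; rewrite normrN (_ : 24^-1 * 4%:R = 6^-1) ?sin_taylor3//; field.
Qed.

Lemma sin_taylor5 x : `|sin x - x + 6^-1 * x ^+ 3| <= 120^-1 * `|x| ^+ 5.
Proof.
apply: (derive_monomial_bound (h := fun t => sin t - t + 6^-1 * t ^+ 3)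
  (h1 := fun t => cos t - 1 + 2^-1 * t ^+ 2)).
- by move=> t; apply: is_derive_eq; rewrite /GRing.scale/=; field.
- by rewrite sin0 subrr expr0n/= mulr0 addr0.
- by move=> t; rewrite (_ : 120^-1 * 5%:R = 24^-1) ?cos_taylor4//; field.
Qed.

Lemma F3_intro f (f1 f2 : R -> R) M :
  (forall x, is_derive x 1 f (f1 x)) -> (forall x, is_derive x 1 f1 (f2 x)) ->
  continuous f2 -> (forall x y, `|f2 x - f2 y| <= `|x - y|) ->
  (forall x, `|f x| <= M) -> F3 f.
Proof.
move=> df df1 cf2 f2L fM.
have f1E : derive1 f = f1.
  by apply/funext => x; rewrite derive1E; case: (df x).
have f2E : derive1n 2 f = f2.
  by apply/funext => x; rewrite /derive1n/= f1E derive1E; case: (df1 x).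
split.
- exists M; split; first exact: num_real.
  by move=> y My x _ /=; rewrite (le_trans (fM x))// ltW.
- by move=> x; case: (df x).
- by move=> x; rewrite f1E; case: (df1 x).
- by rewrite f2E.
- by rewrite f2E.
Qed.

Lemma F3_lipschitz f : F3 f ->
  lipschitz_second_derivative 1 f /\ exists M, forall x, `|f x| <= M.
Proof.
move=> [[M [_ fM]] df df1 _ f2L]; split.
  exists (derive1 f), (derive1n 2 f); split.
  - by move=> x; rewrite derive1E; apply: derivableP.
  - by move=> x; rewrite /derive1n/= [X in is_derive _ _ _ X]derive1E; apply: derivableP.
  - by move=> x y; rewrite mul1r.
(* [bounded_fun] only provides bounds strictly larger than [M]. *)
by exists (M + 1) => x; apply: fM => //; rewrite ltrDl.
Qed.

(** With [N = n + 1], never 0, this is [- N^2 x + x^3 / 6] up to an error of order [N^-2], while its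
    second derivative [N sin (x / N)] stays 1-Lipschitz. *)
Definition sine_test n (x : R) : R := - n.+1%:R ^+ 3 * sin (x / n.+1%:R).

Lemma sine_test_bounded n x : `|sine_test n x| <= n.+1%:R ^+ 3.
Proof.
by rewrite normrM normrN normrX normr_nat ler_piMr ?exprn_ge0// sin_max.
Qed.

Lemma sin_lipschitz x y : `|sin x - sin y| <= `|x - y|.
Proof.
wlog xy : x y / x <= y => [wlogH|].
  have [xy|/ltW yx] := leP x y; first exact: wlogH.
  by rewrite distrC [leRHS]distrC wlogH.
move: xy; rewrite le_eqVlt => /predU1P[->|xy]; first by rewrite !subrr.
have [c [_ _]] := mvt_global (fun x => is_derive_sin x) xy.
rewrite distrC [leRHS]distrC => ->.
by rewrite normrM ler_piMl// cos_max.
Qed.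

Lemma sine_test_F3 n : F3 (sine_test n).
Proof.
set N : R := n.+1%:R; have N0 : 0 < N by rewrite ltr0n.
have dN (x : R) : is_derive x 1 (fun x : R => x / N) N^-1.
  by apply: is_derive_eq; rewrite /GRing.scale/=; ring.
apply: (@F3_intro _ (fun x => - N ^+ 2 * cos (x / N)) (fun x => N * sin (x / N)) (N ^+ 3)).
- move=> x; have dS := is_derive1_comp (is_derive_sin _) (dN x).
  rewrite (_ : sine_test n = (- N ^+ 3) *: (sin \o (fun x => x / N)))//.
  apply: is_derive_eq; rewrite /GRing.scale/=.
  by field; rewrite gt_eqF.
- move=> x; have dS := is_derive1_comp (is_derive_cos _) (dN x).
  rewrite (_ : (fun x => _) = (- N ^+ 2) *: (cos \o (fun x => x / N)))//.
  apply: is_derive_eq; rewrite /GRing.scale/=.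
  by field; rewrite gt_eqF.
- move=> x; apply/differentiable_continuous/derivable1_diffP.
  have dS := is_derive1_comp (is_derive_sin _) (dN x).
  by case: (is_deriveZ N dS).
- move=> x y; rewrite -mulrBr normrM [`|N|]gtr0_norm//.
  rewrite -[leRHS](_ : N * `|x / N - y / N| = _); first by rewrite ler_pM2l// sin_lipschitz.
  by rewrite -{1}(gtr0_norm N0) -normrM mulrBr ![N * _]mulrC !divfK// gt_eqF.
- exact: sine_test_bounded.
Qed.

(** The bound is uniform in [n] and serves as the dominating function for the limit. *)
Lemma sine_test_cubic_bound n x : `|n.+1%:R ^+ 2 * x + sine_test n x| <= 6^-1 * `|x| ^+ 3.
Proof.
rewrite /sine_test; set N : R := n.+1%:R; have N0 : 0 < N by rewrite ltr0n.
have -> : N ^+ 2 * x + - N ^+ 3 * sin (x / N) = - N ^+ 3 * (sin (x / N) - x / N).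
  by field; rewrite gt_eqF.
rewrite normrM normrN [`|N ^+ 3|]gtr0_norm ?exprn_gt0//.
apply: (@le_trans _ _ (N ^+ 3 * (6^-1 * `|x / N| ^+ 3))).
  by rewrite ler_pM2l ?exprn_gt0// sin_taylor3.
rewrite normrM normfV (gtr0_norm N0) le_eqVlt; apply/orP; left; apply/eqP.
by field; rewrite gt_eqF.
Qed.

Lemma sine_test_cvg x :
  (fun n => n.+1%:R ^+ 2 * x + sine_test n x) @ \oo --> 6^-1 * x ^+ 3.
Proof.
apply/cvgrPdist_le => e e0.
(* The Taylor error is at most [C / N^2]; as [N >= 1], taking [N >= C / e] is enough. *)
pose C := 120^-1 * `|x| ^+ 5.
have C0 : 0 <= C by rewrite mulr_ge0// exprn_ge0.
near=> n.
have Cn : C / e <= n%:R by near: n; exact: nbhs_infty_ger.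
set N : R := n.+1%:R; have N0 : 0 < N by rewrite ltr0n.
have N1 : 1 <= N by rewrite ler1n.
have -> : 6^-1 * x ^+ 3 - (N ^+ 2 * x + sine_test n x) =
    N ^+ 3 * (sin (x / N) - x / N + 6^-1 * (x / N) ^+ 3).
  by rewrite /sine_test -/N; field; rewrite gt_eqF.
rewrite normrM [`|N ^+ 3|]gtr0_norm ?exprn_gt0//.
apply: (@le_trans _ _ (N ^+ 3 * (120^-1 * `|x / N| ^+ 5))).
  by rewrite ler_pM2l ?exprn_gt0// sin_taylor5.
rewrite normrM normfV (gtr0_norm N0).
rewrite (_ : N ^+ 3 * _ = C / N ^+ 2); last by rewrite /C; field; rewrite gt_eqF.
rewrite ler_pdivrMr ?exprn_gt0//.
have : C / e <= N by rewrite (le_trans Cn)// ler_nat.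
rewrite ler_pdivrMr// => CN.
by rewrite (le_trans CN)// mulrC ler_pM2l// expr2 ler_peMr// ltW.
Unshelve. all: by end_near. Qed.

Lemma sine_test_integral_cvg P t : central_moments P 0 1 t ->
  (fun n => \int[P]_x sine_test n x) @ \oo --> t / 6.
Proof.
move=> [iP P1 _ P3].
have i3 := integrable_central_pow 0 (isT : (3 <= 3)%N) iP.
have i1 := integrable_central_pow 0 (isT : (1 <= 3)%N) iP.
have ms n : measurable_fun setT (sine_test n).
  exact: lipschitz_second_derivative_measurable (F3_lipschitz (sine_test_F3 n)).1.
have is_ n : P.-integrable setT (EFin \o sine_test n).
  exact: (integrable_bounded P (ms n) (@sine_test_bounded n)).
(* Adding [N^2 x] leaves the integral unchanged, since the mean is 0, and removes the divergent
   linear part. *)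
pose g n x := n.+1%:R ^+ 2 * x + sine_test n x.
have mg n : measurable_fun setT (g n).
  by apply: measurable_funD => //; exact: measurable_funM.
have gE n : \int[P]_x g n x = \int[P]_x sine_test n x.
  rewrite RintegralD//; last first.
    have := integrableZl measurableT (n.+1%:R ^+ 2) i1.
    by apply: eq_integrable => // x _; rewrite subr0.
  rewrite RintegralZl//.
    have -> : \int[P]_x x = 0 by rewrite -P1; apply: eq_Rintegral => x _; rewrite subr0.
    by rewrite mulr0 add0r.
  by apply: eq_integrable i1 => // x _; rewrite subr0.
have mc : measurable_fun setT (fun x : R => (6^-1 * x ^+ 3)%:E).
  by apply/measurable_EFinP; apply: measurable_funM => //; exact: measurable_funX.
have ic : P.-integrable setT (fun x : R => (6^-1 * x ^+ 3)%:E).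
  have := integrableZl measurableT 6^-1 i3.
  by apply: eq_integrable => // x _; rewrite subr0.
have [|||||_ _ dct] := @dominated_convergence _ _ _ P setT measurableT
  (fun n => EFin \o g n) (fun x : R => (6^-1 * x ^+ 3)%:E)
  (fun x : R => (6^-1 * `|x| ^+ 3)%:E).
- by move=> n; exact/measurable_EFinP.
- exact: mc.
- by apply: aeW => x _; apply: cvg_EFin; [exact: nearW|exact: sine_test_cvg].
- exact: (integrableZl measurableT 6^-1 iP).
- by apply: aeW => x n _; rewrite /= lee_fin; exact: sine_test_cubic_bound.
have tE : (\int[P]_x (6^-1 * x ^+ 3)%:E = (t / 6)%:E)%E.
  rewrite -(fineK (integrable_fin_num measurableT ic)); congr (_%:E).
  transitivity (\int[P]_x (6^-1 * (x - 0) ^+ 3)).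
    by apply: eq_Rintegral => x _; rewrite subr0.
  by rewrite RintegralZl// P3 mulrC.
move: dct; rewrite tE => /fine_cvg; apply: cvg_trans.
by rewrite (_ : (fun n => _) = fun n => \int[P]_x g n x)//; apply/funext => n; rewrite gE.
Qed.

Lemma zeta3_ge P Q t t' : central_moments P 0 1 t -> central_moments Q 0 1 t' ->
  ((`|t - t'| / 6)%:E <= zeta3 P Q)%E.
Proof.
move=> cP cQ.
have mem n : (`| \int[P]_x sine_test n x - \int[Q]_x sine_test n x |%:E <= zeta3 P Q)%E.
  apply: ereal_sup_ubound; exists (sine_test n); first exact: sine_test_F3.
  have ms := lipschitz_second_derivative_measurable (F3_lipschitz (sine_test_F3 n)).1.
  have iN (S : law R) := integrable_bounded S ms (@sine_test_bounded n).
  transitivity `| (\int[P]_x sine_test n x)%:E - (\int[Q]_x sine_test n x)%:E |%E => //.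
  by rewrite /Rintegral !fineK ?(integrable_fin_num measurableT (iN _)).
have cvg : (fun n => `| \int[P]_x sine_test n x - \int[Q]_x sine_test n x |%:E) @ \oo
    --> (`|t - t'| / 6)%:E.
  apply: cvg_EFin; first exact: nearW.
  rewrite (_ : `|t - t'| / 6 = `|t / 6 - t' / 6|); last first.
    by rewrite -mulrBl normrM [`|6^-1|]ger0_norm.
  apply: cvg_norm; apply: cvgB; exact: sine_test_integral_cvg.
by apply: (cvge_le _ cvg); exact: nearW.
Qed.

End zeta3_lower_bound.

(** * Moments of standardized laws, and the third moment of a two-point law *)

Section standardization_integrals.
Context {R : realType}.
Implicit Types (P Q : law R) (f : R -> R).

Lemma Rintegral_standardize P f : measurable_fun setT f ->
  P.-integrable setT (fun x : R => (f ((x - mean P) / stddev P))%:E) ->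
  (standardize P).-integrable setT (EFin \o f) /\
  \int[standardize P]_x f x = \int[P]_x f ((x - mean P) / stddev P).
Proof.
move=> mf iP; have mf' : measurable_fun setT (EFin \o f) by exact/measurable_EFinP.
split; first exact: (integrable_pushforward (measurable_std_map P) mf' iP measurableT).
rewrite /Rintegral; congr fine.
exact: (@integral_distribution _ _ _ _ _ P (std_map P)).
Qed.

Lemma central_moments_standardize P m v t : central_moments P m v t -> 0 < v ->
  central_moments (standardize P) 0 1 (t / Num.sqrt v ^+ 3).
Proof.
move=> cP v0; have mE := central_moments_mean cP; have sE := central_moments_stddev cP.
have s0 : 0 < Num.sqrt v by rewrite sqrtr_gt0.
have s2 : Num.sqrt v ^+ 2 = v by rewrite sqr_sqrtr ?ltW.
set s := Num.sqrt v in sE s0 s2 *.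
have [iP P1 P2 P3] := cP.
have ic := integrable_central_pow m _ iP.
have stdX n : (n <= 3)%N -> (standardize P).-integrable setT (fun x : R => (x ^+ n)%:E) /\
    \int[standardize P]_x x ^+ n = (\int[P]_x (x - m) ^+ n) / s ^+ n.
  move=> n3; have mX : measurable_fun setT (fun x : R => x ^+ n) by exact: measurable_funX.
  have [|i ->] := Rintegral_standardize (P := P) mX.
    have := integrableZr measurableT (s ^- n) (ic n n3).
    by apply: eq_integrable => // x _; rewrite mE sE exprMn exprVn.
  split => //; rewrite -RintegralZr ?ic//.
  by apply: eq_Rintegral => x _; rewrite mE sE exprMn exprVn.
have stdB n : (n <= 3)%N ->
    \int[standardize P]_x (x - 0) ^+ n = (\int[P]_x (x - m) ^+ n) / s ^+ n.
  by move=> /stdX[_ <-]; apply: eq_Rintegral => x _; rewrite subr0.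
split.
- have := integrable_norm (stdX 3%N isT).1.
  by apply: eq_integrable => // x _; rewrite /= normrX.
- by have := stdB 1%N isT; rewrite [X in _ = X / _](_ : _ = 0)// mul0r.
- by rewrite stdB// P2 s2 divff// gt_eqF.
- by rewrite stdB// P3.
Qed.

(** With weights [p], [1 - p] and atoms at distance [d], all quantities are explicit in
    [tau = sqrt (p (1 - p))], [|1 - 2 p|] and [d]; in particular [B (rho3 P)] is
    [|1 - 2 p| / tau]. *)
Lemma two_point_centred_moment3 P : P3 P -> two_point P ->
  `|centred_moment3 P| = stddev P ^+ 3 * B (rho3 P).
Proof.
move=> hP [a [b [p [ab /andP[p0 p1] PE]]]].
have p01 : 0 <= p <= 1 by rewrite !ltW.
have int f (mf : measurable_fun setT f) := (integral_two_point p01 PE mf).2.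
have mE : mean P = p * a + (1 - p) * b by rewrite meanE int.
have am : a - mean P = (1 - p) * (a - b) by rewrite mE; ring.
have bm : b - mean P = - p * (a - b) by rewrite mE; ring.
have mB : measurable_fun setT (fun x : R => x - mean P) by exact: measurable_funB.
pose d := `|a - b|; have d0 : 0 < d by rewrite normr_gt0 subr_eq0.
pose tau := Num.sqrt (p * (1 - p)).
have q0 : 0 < 1 - p by lra.
have pq0 : 0 < p * (1 - p) by rewrite mulr_gt0.
have tau0 : 0 < tau by rewrite sqrtr_gt0.
have tau2 : tau ^+ 2 = p * (1 - p) by rewrite sqr_sqrtr// ltW.
have sE : stddev P = tau * d.
  rewrite stddevE int; last exact: measurable_funX.
  rewrite am bm (_ : _ + _ = (tau * d) ^+ 2).
    by rewrite sqrtr_sqr ger0_norm// mulr_ge0 ?ltW.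
  by rewrite [RHS]exprMn tau2 /d real_normK ?num_real//; ring.
have s0 : 0 < stddev P by rewrite sE mulr_gt0.
have m3E : `|centred_moment3 P| = tau ^+ 2 * `|1 - 2 * p| * d ^+ 3.
  rewrite centred_moment3E int; last exact: measurable_funX.
  rewrite am bm (_ : _ + _ = tau ^+ 2 * (1 - 2 * p) * (a - b) ^+ 3); last by rewrite tau2; ring.
  by rewrite [LHS]normrM normrX [X in X * _]normrM (ger0_norm (sqr_ge0 tau)).
(* The standardized law lives on [{u, -1/u}] up to reflection, with [u^2 = (1 - p) / p]; hence
   [u + 1/u = 1 / tau]. *)
pose k := tau^-1.
have k0 : 0 < k by rewrite invr_gt0.
have k2 : 2 <= k.
  rewrite -(ler_pM2r tau0) mulVf ?gt_eqF//.
  by have := sqr_ge0 (1 - 2 * p); nra.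
have rhoE : rho3 P = k - 2 / k.
  rewrite rho3E int; last first.
    apply: measurable_funX; apply: measurableT_comp; first exact: normr_measurable.
    exact: measurable_funM.
  rewrite am bm !normrM normrN normfV (gtr0_norm s0) (gtr0_norm p0) (gtr0_norm q0).
  rewrite -/d sE /k.
  rewrite (_ : _ + _ = tau ^+ 2 * (1 - 2 * tau ^+ 2) / tau ^+ 3).
    by field; rewrite gt_eqF.
  by rewrite tau2; field; rewrite !gt_eqF.
rewrite m3E rhoE B_tangent// sE.
have -> : k ^+ 2 - 4 = (`|1 - 2 * p| / tau) ^+ 2.
  rewrite /k exprVn expr_div_n real_normK ?num_real//.
  by rewrite tau2; field; lra.
rewrite sqrtr_sqr [`|_ / tau|]ger0_norm; last by rewrite divr_ge0// ltW.
by field; rewrite gt_eqF.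
Qed.

End standardization_integrals.

(** * Upper bound by exchange of summands, equality by third moments *)

Theorem theorem1p8 (R : realType) (n : nat) (hn : (0 < n)%N)
    (P : 'I_n -> law R) (hP : forall i, P3 (P i)) :
  let s i := stddev (P i) in
  let Q i := sym_two_point (s i) in
  let sigma := Num.sqrt (\sum_(i < n) s i ^+ 2) in
  let rho i := rho3 (P i) in
  let dist := zeta3 (standardize (convolutions P))
                    (standardize (convolutions Q)) in
  let bound := (6 * sigma ^+ 3)^-1 * \sum_(i < n) s i ^+ 3 * B (rho i) in
  (dist <= bound%:E)%E /\
  ((forall i, two_point (P i)) ->
   (forall i, 0 <= centred_moment3 (P i)) \/
   (forall i, centred_moment3 (P i) <= 0) ->
   dist = bound%:E).
Proof.
move=> s Q sigma rho dist bound.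
have v0 : 0 < \sum_(i < n) s i ^+ 2.
  rewrite (bigD1 (Ordinal hn))//= ltr_pwDl ?exprn_gt0 ?P3_stddev_gt0//.
  by apply: sumr_ge0 => i _; exact: sqr_ge0.
have sg0 : 0 < sigma by rewrite sqrtr_gt0.
have cP := central_moments_convolutions (fun i => P3_central_moments (hP i)).
have cQ := central_moments_convolutions (fun i => central_moments_sym_two_point (s i)).
rewrite -/Q !big1_eq in cQ.
have ub : (dist <= bound%:E)%E.
  apply: ge_ereal_sup => _ [f F3f <-].
  have [lf [M fM]] := F3_lipschitz F3f.
  have mf := lipschitz_second_derivative_measurable lf.
  have intf (S : law R) := integrable_bounded S mf fM.
  have stdE (S : law R) : (\int[standardize S]_x (f x)%:E =
      (\int[S]_x f ((x - mean S) / stddev S))%:E)%E.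
    have iS : S.-integrable setT (fun x : R => (f ((x - mean S) / stddev S))%:E).
      apply: (integrable_bounded S (M := M)) => //.
      by apply: measurableT_comp => //; exact: measurable_std_map.
    have [_ <-] := Rintegral_standardize mf iS.
    by rewrite /Rintegral fineK// (integrable_fin_num measurableT (intf _)).
  rewrite !stdE -EFinB [`|_|%E]/= lee_fin.
  rewrite (central_moments_mean cP) (central_moments_mean cQ).
  rewrite (central_moments_stddev cP) (central_moments_stddev cQ) -/sigma.
  (* Both convolutions have variance [sigma^2], so standardization moves into the test function
     [f (x / sigma)], whose Lipschitz constant is [sigma^-3]. *)
  have := convolutions_dist hP _ (lipschitz_second_derivative_affine sigma^-1 0 lf)
    (fun x => fM _).
  rewrite mul1r normfV (gtr0_norm sg0) exprn_gt0 ?invr_gt0// => /(_ isT).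
  rewrite /bound invfM => H; apply: le_trans (le_trans H _).
    rewrite le_eqVlt; apply/orP; left; apply/eqP; congr `|_ - _|.
      by apply: eq_Rintegral => x _; rewrite addr0 mulrC.
    by apply: eq_Rintegral => x _; rewrite addr0 subr0 mulrC.
  by rewrite le_eqVlt; apply/orP; left; apply/eqP; rewrite exprVn /s /rho; ring.
split => // tP sgn; apply/eqP; rewrite eq_le ub/=.
have cPs := central_moments_standardize cP v0.
have cQs := central_moments_standardize cQ v0.
apply: le_trans (zeta3_ge cPs cQs).
(* The symmetric side has third moment 0, so only the sum of the centred third moments of the [P i]
   remains. *)
rewrite lee_fin -/sigma mul0r subr0 normrM normfV [`|sigma ^+ 3|]gtr0_norm ?exprn_gt0//.
rewrite (_ : `|\sum_i centred_moment3 (P i)| = \sum_(i < n) s i ^+ 3 * B (rho i)).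
  by rewrite /bound invfM le_eqVlt; apply/orP; left; apply/eqP; ring.
under [RHS]eq_bigr => i _ do rewrite -(two_point_centred_moment3 (hP i) (tP i)).
(* Equal signs exclude cancellation: the absolute value of the sum is the sum of the absolute
   values. *)
case: sgn => sgn.
  rewrite ger0_norm; last by apply: sumr_ge0.
  by apply: eq_bigr => i _; rewrite ger0_norm.
rewrite ler0_norm; last by apply: sumr_le0.
by rewrite -sumrN; apply: eq_bigr => i _; rewrite ler0_norm.
Qed.
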